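(* Let $\pi$ be a Borel probability measure on $\mathcal{X}$, let $(\mathcal{P}_\gamma)_{\gamma\in\mathcal{Y}}$ be a family of Borel Markov kernels on $\mathcal{X}$, let $\mathcal{Q}$ be an adaptation plan, and let $(\Gamma_t,X_t)_{t\ge0}$ be the adaptive process with plan $\mathcal{Q}$ initialized at $(\gamma_0,x_0)\in\mathcal{Y}\times\mathcal{X}$. Assume: 1. $\pi\mathcal{P}_\gamma=\pi$ for all $\gamma\in\mathcal{Y}$. 2. (Simultaneous subgeometric drift) There are a Borel function $V:\mathcal{X}\to[1,\infty)$ with $\int_{\mathcal{X}}V\,d\pi<\infty$, a concave function $\phi:[0,\infty)\to[0,\infty)$ strictly increasing to infinity with $\lim_{v\to\infty}\phi(v)/v=0$, and a constant $K\ge0$ such that $\int_{\mathcal{X}}V(y)\,\mathcal{P}_\gamma(x,dy)-V(x)\le-\phi(V(x))+K$ for every $(x,\gamma)\in\mathcal{X}\times\mathcal{Y}$. 3. (Simultaneous local contraction) For some $\delta\in(0,1)$, with $R=\phi^{-1}[2K/(1-\delta)]$ and $S=\{(x,y)\in\mathcal{X}\times\mathcal{X}:V(x)+V(y)\le R\}$, there is a constant $\alpha\in(0,1)$ such that $\|\mathcal{P}_\gamma(x,\cdot)-\mathcal{P}_\gamma(y,\cdot)\|_{\mathrm{TV}}\le1-\alpha$ for all $(x,y)\in S$ and $\gamma\in\mathcal{Y}$. 4. (Quantitative diminishing adaptation) There is a function $G:\mathbb{Z}_+\to(0,\infty)$ strictly decreasing to $0$ such that for any $\epsilon\in(0,1)$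 there is a nonnegative integer $s_\epsilon$ such that, with probability at least $1-\epsilon$, $\|\mathcal{P}_{\Gamma_{t+1}}(x,\cdot)-\mathcal{P}_{\Gamma_t}(x,\cdot)\|_{\mathrm{TV}}\le G(t)$ holds for all $x\in\mathcal{X}$ and all $t\ge s_\epsilon$, and this event is Borel measurable. Then for any $\epsilon\in(0,1)$ and all $t$ sufficiently large, $$\left\|\mathcal{A}_{\mathcal{Q}}^{(T_{\epsilon,t}+t)}((\gamma_0,x_0),\cdot)-\pi\right\|_{\mathrm{TV}}\le\frac{2+[r(1)/r(0)]\left(V(x_0)+\int_{\mathcal{X}}V\,d\pi+KT_{\epsilon,t}\right)+C}{H_{1,\delta\phi}^{-1}\left(\dfrac{t}{-\log(H_{1,\delta\phi}^{-1}(t))/\log(1-\alpha)+1}\right)}+2\epsilon,$$ where $T_{\epsilon,t}=s_\epsilon+\lceil(1/G)^{-1}(t^2/\epsilon)\rceil$, $r(\cdot)=\delta\phi(H_{1,\delta\phi}^{-1}(\cdot))$, and $$C=\frac{r(1)}{r(0)}\left\{R+\frac{2Kr(1)}{r(0)}\right\}.$$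
   Context: $\mathcal{X}$ is a Polish space (state space) and $\mathcal{Y}$ is a Borel measurable space (tuning parameters), with Borel sigma-algebras $\mathcal{B}(\mathcal{X}),\mathcal{B}(\mathcal{Y})$. $\mathbb{Z}_+$ denotes the positive integers. $(\mathcal{P}_\gamma)_{\gamma\in\mathcal{Y}}$ is a family of Markov kernels $\mathcal{P}_\gamma:\mathcal{X}\times\mathcal{B}(\mathcal{X})\to[0,1]$ such that $(x,\gamma)\mapsto\mathcal{P}_\gamma(x,\cdot)$ is Borel measurable; $(\mu\mathcal{P}_\gamma)(\cdot)=\int_{\mathcal{X}}\mathcal{P}_\gamma(x,\cdot)\,\mu(dx)$. Adaptive process: an adaptation plan $\mathcal{Q}$ is a sequence $(\mathcal{Q}_t)_{t\in\mathbb{Z}_+}$ of Borel probability kernels $\mathcal{Q}_t:(\mathcal{Y}\times\mathcal{X})^t\times\mathcal{B}(\mathcal{Y})\to[0,1]$. Given $\mathcal{Q}$ and a fixed initialization $(\Gamma_0,X_0)=(\gamma_0,x_0)$, the adaptive process $(\Gamma_t,X_t)_{t\ge0}$ is defined for $t\ge1$ by $\Gamma_t\mid(\Gamma_s,X_s)_{0\le s\le t-1}\sim\mathcal{Q}_t((\Gamma_s,X_s)_{0\le s\le t-1},\cdot)$ and then, conditionally on $\Gamma_t$ and the past, $X_t\sim\mathcal{P}_{\Gamma_t}(X_{t-1},\cdot)$. The marginal law of $X_t$ is denoted $\mathcal{A}_{\mathcal{Q}}^{(t)}((\gamma_0,x_0),\cdot)$. Total variation: $\|\mu-\nu\|_{\mathrm{TV}}=\inf_{\xi}\xi(\{(x,y):x\ne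 y\})$, the infimum over all couplings $\xi$ of $\mu$ and $\nu$ on $\mathcal{X}\times\mathcal{X}$. $H_{1,\delta\phi}(w)=\int_1^w\frac{dv}{\delta\phi(v)}$ for $w\ge1$, and $H_{1,\delta\phi}^{-1}:[0,\infty)\to[1,\infty)$ is its inverse. For a real-valued function $F$ whose inverse is not well defined, $F^{-1}(u)=\inf\{x:F(x)\ge u\}$ denotes the generalized inverse; in particular $(1/G)^{-1}(u)=\inf\{s\in\mathbb{Z}_+:1/G(s)\ge u\}$. *)

(* Defs.v *)
From HB Require Import structures.
From mathcomp Require Import all_boot all_order all_algebra.
From mathcomp Require Import all_classical all_reals all_analysis.
Set Implicit Arguments.
Unset Strict Implicit.
Unset Printing Implicit Defensive.
Import Order.TTheory GRing.Theory Num.Theory.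
Import numFieldNormedType.Exports.
Local Open Scope classical_set_scope.
Local Open Scope ring_scope.

Notation borel T := (g_sigma_algebraType (@open T)).

Record complete_metric_for (R : realType) (T : topologicalType)
    (dist : T -> T -> R) : Prop := {
  dist_ge0 : forall x y, 0 <= dist x y;
  dist_eq0 : forall x y, dist x y = 0 <-> x = y;
  dist_sym : forall x y, dist x y = dist y x;
  dist_triangle : forall x y z, dist x z <= dist x y + dist y z;
  dist_nbhs : forall x (A : set T), nbhs x A <->
    exists2 e, 0 < e & [set y | dist x y < e] `<=` A;
  dist_complete : forall u : nat -> T,
    (forall e, 0 < e -> exists N : nat, forall m n : nat,
       (N <= m)%N -> (N <= n)%N -> dist (u m) (u n) < e) ->
    exists l : T, u @ \oo --> l }.

Definition polish (R : realType) (T : topologicalType) : Prop :=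
  (exists2 D : set T, countable D & dense D) /\
  exists dist : T -> T -> R, complete_metric_for dist.

Definition coupling d (T : measurableType d) (R : realType)
    (mu nu : set T -> \bar R) : set (probability (T * T)%type R) :=
  [set xi | forall A : set T, measurable A ->
     xi (fst @^-1` A) = mu A /\ xi (snd @^-1` A) = nu A].

Definition tv d (T : measurableType d) (R : realType)
    (mu nu : set T -> \bar R) : \bar R :=
  ereal_inf [set xi [set z : T * T | z.1 <> z.2] | xi in coupling mu nu].

(* The kernel k is a version of the conditional law of W given Z under Pr. *)
Definition cond_law d d1 d2 (Om : measurableType d) (U : measurableType d1)
    (T : measurableType d2) (R : realType) (Pr : probability Om R)
    (Z : Om -> U) (W : Om -> T) (k : U -> {measure set T -> \bar R}) : Prop :=
  forall (A : set U) (B : set T), measurable A -> measurable B ->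
    (Pr (Z @^-1` A `&` W @^-1` B) =
     \int[Pr]_(w in Z @^-1` A) k (Z w) B)%E.

Definition history (Om X Y : Type) (Gam : nat -> Om -> Y) (Xi : nat -> Om -> X)
    (t : nat) (w : Om) : t.-tuple (Y * X) :=
  [tuple (Gam s w, Xi s w) | s < t].

(* Q t.+1 is the law of Gam_(t+1) given the pairs of indices 0, ..., t;
   the kernel Q 0 plays no role. *)
Record adaptive_process (R : realType) (X Y : ptopologicalType)
    (P : R.-pker (borel X * borel Y) ~> borel X)
    (Q : forall t : nat, R.-pker (t.-tuple (borel Y * borel X)) ~> borel Y)
    (gam0 : Y) (x0 : X)
    d (Om : measurableType d) (Pr : probability Om R)
    (Gam : nat -> {mfun Om >-> borel Y}) (Xi : nat -> {mfun Om >-> borel X})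
    : Prop := {
  init_param : forall w, Gam 0%N w = gam0;
  init_state : forall w, Xi 0%N w = x0;
  step_param : forall t : nat,
    cond_law Pr (history Gam Xi t.+1) (Gam t.+1) (Q t.+1);
  step_state : forall t : nat,
    cond_law Pr (fun w => (history Gam Xi t.+1 w, Gam t.+1 w)) (Xi t.+1)
      (fun z => P ((tnth z.1 ord_max).2, z.2)) }.

Section rates.
Context (R : realType).
Implicit Types (phi : R -> R) (delta u w : R).

Definition concave_on (D : set R) phi : Prop :=
  @convex_function R R^o D (fun v => - phi v).

(* Generalized inverse on `[0, +oo[: a concave phi may jump at 0, or be positive
   there, so that u need not be a value of phi. *)
Definition phi_inv phi u : R := inf [set v | 0 <= v /\ u <= phi v].

(* Generalized inverse of 1/G, where G is a function on the positive integers: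
   G 0 plays no role. *)
Definition recip_inv (G : nat -> R) u : R :=
  inf [set s%:R | s in [set s : nat | (0 < s)%N /\ u <= (G s)^-1]].

Definition H1 delta phi w : R :=
  \int[lebesgue_measure]_(v in `[1, w]) (delta * phi v)^-1.

(* When phi is nonnegative, increasing and concave, H1 delta phi is a bijection
   from `[1, +oo[ to `[0, +oo[, and this is its inverse; values at negative
   arguments are meaningless. *)
Definition H1_inv delta phi : R -> R := 
  @pinv_ R R (fun=> 1) `[1, +oo[ (H1 delta phi).

Definition rate delta phi u : R := delta * phi (H1_inv delta phi u).

End rates.

(* Main.v *)
Require Import Defs.
From HB Require Import structures.
From mathcomp Require Import all_boot all_order all_algebra.
From mathcomp Require Import all_classical all_reals all_analysis.
From mathcomp Require Import measurable_realfun.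
From mathcomp Require Import ring lra.
Set Implicit Arguments.
Unset Strict Implicit.
Unset Printing Implicit Defensive.
Import Order.TTheory GRing.Theory Num.Theory.
Import numFieldNormedType.Exports.
Local Open Scope classical_set_scope.
Local Open Scope ring_scope.

(** Why the bound holds. Write [H = H1 delta phi], a primitive of
[1 / (delta * phi)], and let [q] be the denominator
[- ln (Hinv t) / ln (1 - alpha) + 1] and [M = Hinv (t / q)], the quantity by
which the first term of the bound is divided. Since [phi] increases, [H] is
concave; and [q] tends to infinity with [t].

Slack. Adaptation costs [eps] for the event on which the kernels change too
fast. Outside this event every change after time [T] is at most [eps / t ^ 2],
so that [i.+1 * eps / t ^ 2] bounds the distance between the kernel of step
[T + i + 1] and the kernel of time [T], and the sum over the [t] steps is
[eps * (t + 1) / (2 * t)]. The term [2 * eps] of the bound therefore leaves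
almost [eps / 2] for the error of the chain that keeps the parameter of time
[T], and any vanishing error is absorbed for large [t]
([eventually_within_slack]): a bound of order [1 / t] suffices.

The frozen chain. Run two copies with the same fixed parameter from [x] and
[y], and let [W = V x + V y]. By the drift condition and the subadditivity of
the concave function [phi], the mean of [W] decreases by at least
[delta * phi W] in one step from outside the contraction set; as [H] lies below
its tangents, the mean of [H W] then decreases by at least 1. In the
contraction set it increases by at most a constant [b], but there the copies
can be made to meet with probability [alpha]. Hence, for every [c > 0], the
n-step expectations of a function with values in [0, 1] differ by at most
[max (1 - c * n) (c * (b + 1) / alpha) + c * H W]: outside the set the decrease
of [H W] pays for the one of [1 - c * n], and inside it a fraction [alpha] of
the maximum pays for the increase of [H W] ([propagate_gap_step]). With
[c = 1 / t] and [n = t] this is [((b + 1) / alpha + H W) / t]. When [W <= M]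
it is at most [(b + 1) / (alpha * t) + 1 / q], which vanishes; when [W > M] the
trivial bound 1 is at most [W / M]. Integrating over [y] under [pi] leaves
[(V x + \int V dpi) / M] plus a vanishing term ([frozen_convergence]), and the
mean of [V] at time [T] is at most [V x0 + K * T] ([mean_drift]).

Adaptation. The event that all changes are small is not determined by the past
of any given step, so it cannot be conditioned on; [frozen_comparison] replaces
it by tests that the past determines and that succeed on this event, and stops
comparing at the first failure.

Total variation is an infimum over couplings. [tv_transport] uses couplings of
two fixed laws only, so that no measurable choice of couplings is needed, and
[tv_le] returns from sets to couplings by the maximal coupling. *)

(** * Integrals of bounded and of nonnegative functions *)

Section integrability.
Context d (T : measurableType d) (R : realType).

Lemma bounded01_integrable (mu : probability T R) (f : T -> R) :
  measurable_fun setT f -> (forall x, 0 <= f x <= 1) ->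
  mu.-integrable setT (EFin \o f).
Proof.
move=> mf f01; apply: measurable_bounded_integrable => //.
  by rewrite (le_lt_trans (probability_le1 _ _))// ltry.
exists 1; split; first exact: num_real.
move=> M M1 x _ /=; have /andP[f0 f1] := f01 x.
by rewrite ger0_norm// (le_trans f1)// ltW.
Qed.

Lemma probability_integrable_cst (mu : probability T R) (r : R) :
  mu.-integrable setT (EFin \o cst r).
Proof.
apply: measurable_bounded_integrable => //.
  by rewrite (le_lt_trans (probability_le1 _ _))// ltry.
exact: bounded_cst.
Qed.

Lemma probability_Rintegral_cst (mu : probability T R) (r : R) :
  \int[mu]_x r = r.
Proof.
rewrite (Rintegral_cst mu)//.
by have := probability_setT mu => /= ->; rewrite mulr1.
Qed.

Lemma nonneg_integrable (mu : {measure set T -> \bar R}) (f : T -> R) :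
  measurable_fun setT f -> (forall x, 0 <= f x) ->
  (\int[mu]_x (f x)%:E < +oo)%E -> mu.-integrable setT (EFin \o f).
Proof.
move=> mf f0 fi; apply/integrableP; split; first exact/measurable_EFinP.
by under eq_integral do rewrite /= ger0_norm//.
Qed.

End integrability.

(** * Total variation and couplings *)

Section diagonal.
Context (R : realType) (T : ptopologicalType).

(** This makes the off-diagonal event of a coupling measurable for the product of
the Borel sigma-algebras. Two points are distinct exactly when one of countably
many balls contains the first and not the second. *)
Lemma polish_diagonal_measurable : polish R T ->
  measurable [set z : borel T * borel T | z.1 <> z.2].
Proof.
move=> [[D cD dD] [dist dm]].
pose B (x : T) (n : nat) := [set y : T | dist x y < n.+1%:R^-1].
have oB x n : open (B x n).
  rewrite openE => y /= xy; apply/(dist_nbhs dm).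
  exists (n.+1%:R^-1 - dist x y); first by rewrite subr_gt0.
  move=> z /= yz; rewrite /B /=.
  by rewrite (le_lt_trans (dist_triangle dm x y z))// -ltrBrDl.
have -> : [set z : borel T * borel T | z.1 <> z.2] =
    \bigcup_(x in [set: set_type D]) \bigcup_n (B (set_val x) n `*` ~` B (set_val x) n).
  apply/seteqP; split => [[y z] /= yz|[y z] /= [x _ [n _ [/= xy xz]]] yz]; last first.
    by rewrite yz in xy.
  have dyz : 0 < dist y z.
    rewrite lt_neqAle (dist_ge0 dm) andbT eq_sym; apply/eqP.
    by move/(dist_eq0 dm).
  have [n n0] : exists n : nat, n.+1%:R^-1 < dist y z / 2.
    exists (Num.truncn (dist y z / 2)^-1).
    by rewrite invf_plt ?posrE ?divr_gt0// truncnS_gt.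
  have [x [yx Dx]] : B y n `&` D !=set0.
    apply: dD => //; exists y; rewrite /B /=.
    by rewrite ((dist_eq0 dm) y y).2.
  exists (SigSub (mem_set Dx)) => //; exists n => //; split => /=.
    by rewrite /B/= (dist_sym dm).
  rewrite /B /=; apply/negP; rewrite -leNgt.
  rewrite -(lerD2l (dist y x)); apply: le_trans (dist_triangle dm y x z).
  by rewrite -lerBrDr; apply: ltW; apply: lt_le_trans yx _;
  move: (_^-1) n0 => e; lra.
apply: countable_bigcupT_measurable.
  by rewrite /countable (card_le_eql (card_setT D)).
move=> x; apply: bigcupT_measurable => n.
apply: measurableX.
  exact: sub_sigma_algebra.
apply: measurableC; exact: sub_sigma_algebra.
Qed.

End diagonal.

Section maximal_coupling.
Context d (T : measurableType d) (R : realType).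
Hypothesis mdiag : measurable [set z : T * T | z.1 <> z.2].

(** The maximal coupling: with a Hahn decomposition of [mu - nu] into a positive
set [P] and a negative set [N], the common part [m] of [mu] and [nu] is put on
the diagonal, and the excesses [p = mu - m] and [q = nu - m], of equal mass
[beta], are coupled independently. Only the second part charges the complement
of the diagonal, and [beta = mu P - nu P]. *)
Lemma tv_le (mu nu : probability T R) (c : R) :
  (forall A, measurable A -> mu A <= nu A + c%:E)%E -> (tv mu nu <= c%:E)%E.
Proof.
move=> munu.
pose dif : {charge set T -> \bar R} :=
  cadd (charge_of_finite_measure mu)
       (cscale (-1) (charge_of_finite_measure nu)).
have difE A : dif A = (mu A - nu A)%E.
  by congr (_ + _)%E; exact: mulN1e.
have [P [N PN]] := Hahn_decomposition dif.
have [[mP _] [mN _] PNT PN0] := PN.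
pose p := jordan_pos PN; pose q := jordan_neg PN.
have fin (k : probability T R) A B : measurable A -> measurable B ->
    k (A `&` B) \is a fin_num.
  by move=> mA mB; rewrite fin_num_measure//; exact: measurableI.
have pE A : measurable A -> p A = (mu (A `&` P) - nu (A `&` P))%E.
  by move=> mA; rewrite /p jordan_posE cjordan_posE /crestr0 mem_set//= /crestr difE.
have qE A : measurable A -> q A = (nu (A `&` N) - mu (A `&` N))%E.
  move=> mA; rewrite /q jordan_negE cjordan_negE /crestr0 mem_set//= /crestr difE.
  have nuf : nu (A `&` N) \is a fin_num by exact: fin.
  by rewrite fin_num_oppeB// [RHS]addeC.
pose m := measure_add (mrestr nu mP) (mrestr mu mN).
have mE A : m A = (nu (A `&` P) + mu (A `&` N))%E by exact: measure_addE.
have split (k : probability T R) A : measurable A ->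
    k A = (k (A `&` P) + k (A `&` N))%E.
  move=> mA; rewrite -measureU; [|exact: measurableI|exact: measurableI|].
    by rewrite -setIUr PNT setIT.
  by rewrite setIACA PN0 setI0.
have muE A : measurable A -> mu A = (m A + p A)%E.
  move=> mA; rewrite pE// mE (split mu)//.
  rewrite addeAC; congr (_ + _)%E.
  by rewrite addeCA subee ?adde0//; exact: fin.
have nuE A : measurable A -> nu A = (m A + q A)%E.
  move=> mA; rewrite qE// mE (split nu)//.
  rewrite -addeA; congr (_ + _)%E.
  by rewrite addeCA subee ?adde0//; exact: fin.
pose beta := fine (p setT).
have pfin A : measurable A -> p A \is a fin_num by move=> mA; rewrite fin_num_measure.
have mfin A : measurable A -> m A \is a fin_num.
  by move=> mA; rewrite mE fin_numD !fin.
have beta0 : 0 <= beta by rewrite fine_ge0.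
have pT : p setT = beta%:E by rewrite fineK// pfin.
have qT : q setT = beta%:E.
  have e : (q setT + m setT = p setT + m setT)%E.
    by rewrite addeC -nuE// addeC -muE// !probability_setT.
  by rewrite -pT -(addeK (q setT) (mfin _ measurableT)) e addeK// mfin.
have betac : beta <= c.
  rewrite -lee_fin -pT pE// setTI leeBlDl; last by rewrite -(setTI P) fin.
  exact: munu.
(* For [beta = 0], where [beta^-1 = 0], both sides vanish. *)
have beta_cancel (k : {measure set T -> \bar R}) A : measurable A ->
    k setT = beta%:E -> ((beta^-1)%:E * (k A * beta%:E) = k A)%E.
  move=> mA kT.
  have [b0|b0] := eqVneq beta 0.
    have -> : k A = 0%E.
      by apply/eqP; rewrite -measure_le0 -[leRHS]/(0%:E) -b0 -kT le_measure ?inE.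
    by rewrite mul0e mule0.
  have kAfin : k A \is a fin_num.
    rewrite ge0_fin_numE// (le_lt_trans (_ : _ <= beta%:E)%E) ?ltry//.
    by rewrite -kT le_measure ?inE.
  by rewrite -(fineK kAfin) -!EFinM mulrCA mulVf// mulr1.
pose dg (x : T) : T * T := (x, x).
have mdg : measurable_fun setT dg by exact: measurable_fun_pair.
have binv0 : 0 <= beta^-1 by rewrite invr_ge0.
pose xi_ := measure_add (pushforward m dg) (mscale (NngNum binv0) (p \x q)%E).
pose xi0 := xi_ mdg.
have xi0E C : xi0 C = (m (dg @^-1` C) + (beta^-1)%:E * (p \x q) C)%E.
  exact: measure_addE.
have pqE A B : measurable A -> measurable B -> (p \x q)%E (A `*` B) = (p A * q B)%E.
  by move=> mA mB; exact: product_measure1E.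
have xi01 : xi0 setT = 1%E.
  rewrite xi0E preimage_setT -setXTT pqE// qT beta_cancel// -muE//.
  exact: probability_setT.
pose xi : probability (T * T)%type R :=
  HB.pack (Measure.sort xi0) (Measure_isProbability.Build _ _ _ xi0 xi01).
apply: le_trans (ereal_inf_lbound _) _.
  exists xi; last reflexivity.
  move=> A mA; split; rewrite [LHS]xi0E.
    rewrite (_ : dg @^-1` (fst @^-1` A) = A)// -setXT pqE// qT.
    rewrite beta_cancel//.
    exact: esym (muE _ mA).
  rewrite (_ : dg @^-1` (snd @^-1` A) = A)// -setTX pqE// pT.
  rewrite [X in (_ + _ * X)%E]muleC beta_cancel//.
  exact: esym (nuE _ mA).
rewrite [leLHS]xi0E.
have -> : dg @^-1` [set z | z.1 <> z.2] = set0.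
  by apply/seteqP; split => // x /= /(_ erefl).
rewrite mE !set0I !measure0 !add0e.
apply: (@le_trans _ _ ((beta^-1)%:E * (p \x q) setT)%E).
  by rewrite lee_wpmul2l ?lee_fin// le_measure ?inE.
by rewrite -setXTT pqE// qT beta_cancel// [leLHS]pT lee_fin.
Qed.

Lemma tv_le1 (mu nu : probability T R) : (tv mu nu <= 1)%E.
Proof.
apply: tv_le => A mA; rewrite (le_trans (probability_le1 _ mA))//.
by rewrite leeDr.
Qed.

End maximal_coupling.

Section coupling_inequality.
Context d (T : measurableType d) (R : realType).

Section marginals.
Variables (mu nu : probability T R) (xi : probability (T * T)%type R).
Hypothesis xiC : coupling mu nu xi.

Lemma coupling_fst_integrable (f : T -> R) : mu.-integrable setT (EFin \o f) ->
  xi.-integrable setT (EFin \o (f \o fst)).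
Proof.
move=> /integrableP[mf fi]; have mf' : measurable_fun setT f by exact/measurable_EFinP.
apply/integrableP; split.
  by apply/measurable_EFinP; apply: measurableT_comp => //.
move: fi; rewrite (eq_measure_integral (pushforward xi fst)); last first.
  by move=> A mA _; have [e _] := xiC mA; exact: esym e.
rewrite ge0_integral_pushforward//; exact: measurableT_comp.
Qed.

Lemma coupling_snd_integrable (f : T -> R) : nu.-integrable setT (EFin \o f) ->
  xi.-integrable setT (EFin \o (f \o snd)).
Proof.
move=> /integrableP[mf fi]; have mf' : measurable_fun setT f by exact/measurable_EFinP.
apply/integrableP; split.
  by apply/measurable_EFinP; apply: measurableT_comp => //.
move: fi; rewrite (eq_measure_integral (pushforward xi snd)); last first.
  by move=> A mA _; have [_ e] := xiC mA; exact: esym e.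
rewrite ge0_integral_pushforward//; exact: measurableT_comp.
Qed.

Lemma coupling_fst_Rintegral (f : T -> R) : mu.-integrable setT (EFin \o f) ->
  \int[mu]_x f x = \int[xi]_z f z.1.
Proof.
move=> fi; rewrite /Rintegral; congr fine.
rewrite (eq_measure_integral (pushforward xi fst)); last first.
  by move=> A mA _; have [e _] := xiC mA; exact: esym e.
have I := coupling_fst_integrable fi.
by rewrite integral_pushforward//; exact: (measurable_int _ fi).
Qed.

Lemma coupling_snd_Rintegral (f : T -> R) : nu.-integrable setT (EFin \o f) ->
  \int[nu]_x f x = \int[xi]_z f z.2.
Proof.
move=> fi; rewrite /Rintegral; congr fine.
rewrite (eq_measure_integral (pushforward xi snd)); last first.
  by move=> A mA _; have [_ e] := xiC mA; exact: esym e.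
have I := coupling_snd_integrable fi.
by rewrite integral_pushforward//; exact: (measurable_int _ fi).
Qed.

End marginals.

Hypothesis mdiag : measurable [set z : T * T | z.1 <> z.2].

(** The one-step estimate of the coupling method, integrated: under a coupling of
[mu] and [nu] that is almost optimal for the total variation, the indicator
contributes [a * th], while the additive term in [V] depends on the marginals
alone and so does not see the coupling. *)
Lemma tv_transport (mu nu : probability T R) (f V : T -> R) (th a b c : R) :
  measurable_fun setT f -> (forall x, 0 <= f x <= 1) ->
  mu.-integrable setT (EFin \o V) -> nu.-integrable setT (EFin \o V) ->
  0 <= a -> (tv mu nu <= th%:E)%E ->
  (forall x y, f x - f y <= a * \1_[set z : T * T | z.1 <> z.2] (x, y) + b +
                            c * (V x + V y)) ->
  \int[mu]_x f x - \int[nu]_x f x <=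
    a * th + b + c * (\int[mu]_x V x + \int[nu]_x V x).
Proof.
move=> mf f01 muV nuV a0 tvth fV.
pose D := [set z : T * T | z.1 <> z.2]; have mD : measurable D := mdiag.
rewrite -/D in fV.
have muf := bounded01_integrable mu mf f01.
have nuf := bounded01_integrable nu mf f01.
apply/ler_addgt0Pr => e e0.
(* The excess [e / (a + 1)] over [th] costs at most [e] after multiplication by
   [a], also when [a = 0]. *)
have a1 : 0 < a + 1 by rewrite ltr_wpDl.
have : (tv mu nu < (th + e / (a + 1))%:E)%E.
  by rewrite (le_lt_trans tvth)// lte_fin ltrDl divr_gt0.
move=> /ereal_inf_lt[_ [xi xiC <-]] xiD.
have I1 := coupling_fst_integrable xiC muf.
have I2 := coupling_snd_integrable xiC nuf.
have I3 := coupling_fst_integrable xiC muV.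
have I4 := coupling_snd_integrable xiC nuV.
have I5 : xi.-integrable setT (EFin \o \1_D).
  by apply: integrable_indic => //; rewrite (le_lt_trans (probability_le1 _ _))// ltry.
have Ib := probability_integrable_cst xi b.
have xiDE : \int[xi]_z \1_D z = fine (xi D).
  by rewrite /Rintegral integral_indic// setIT.
have xiDlt : fine (xi D) < th + e / (a + 1).
  by rewrite -lte_fin fineK// fin_num_measure.
rewrite (coupling_fst_Rintegral xiC muf) (coupling_snd_Rintegral xiC nuf).
rewrite (coupling_fst_Rintegral xiC muV) (coupling_snd_Rintegral xiC nuV).
rewrite -RintegralB// -RintegralD//.
have IaD : xi.-integrable setT (EFin \o (fun z => a * \1_D z)).
  exact: (integrableZl measurableT a I5).
have IVV : xi.-integrable setT (EFin \o (fun z => V z.1 + V z.2)).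
  exact: (integrableD measurableT I3 I4).
have IcV : xi.-integrable setT (EFin \o (fun z => c * (V z.1 + V z.2))).
  exact: (integrableZl measurableT c IVV).
have IaDb : xi.-integrable setT (EFin \o (fun z => a * \1_D z + b)).
  exact: (integrableD measurableT IaD Ib).
have le1 : \int[xi]_z (f z.1 - f z.2) <=
    \int[xi]_z (a * \1_D z + b + c * (V z.1 + V z.2)).
  apply: le_Rintegral => //.
  - exact: (integrableB measurableT I1 I2).
  - exact: (integrableD measurableT IaDb IcV).
apply: le_trans; first exact: le1.
rewrite (RintegralD measurableT IaDb IcV) (RintegralD measurableT IaD Ib).
rewrite (RintegralZl a _ I5)// (RintegralZl c _ IVV)//.
rewrite [\int[xi]_x cst b x]probability_Rintegral_cst.
rewrite xiDE.
have : a * fine (xi D) <= a * (th + e / (a + 1)) by rewrite ler_wpM2l// ltW.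
have : a * (e / (a + 1)) <= e.
  by rewrite mulrCA ler_piMr ?(ltW e0)// ler_pdivrMr// mul1r lerDl.
lra.
Qed.

Lemma tv_Rintegral_le (mu nu : probability T R) (h : T -> R) (eta : R) :
  measurable_fun setT h -> (forall x, 0 <= h x <= 1) ->
  (tv mu nu <= eta%:E)%E ->
  \int[mu]_x h x <= \int[nu]_x h x + eta.
Proof.
move=> mh h01 tveta.
have := tv_transport mh h01 (probability_integrable_cst mu 0)
  (probability_integrable_cst nu 0) (a := 1) (b := 0) (c := 0)
  ler01 tveta.
rewrite mul1r addr0 mul0r addr0 -lerBlDl; apply => x y.
rewrite mul0r !addr0 mul1r indicE; case: (pselect (x = y)) => [->|xy].
  by rewrite subrr.
rewrite mem_set//=; have /andP[_ hx] := h01 x; have /andP[hy _] := h01 y.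
by rewrite lerBlDr ler_wpDr.
Qed.

End coupling_inequality.

(** * The function H and its inverse *)

Section drift_clock.
Context (R : realType) (phi : R -> R) (delta : R).
Hypothesis phi_ge0 : forall v : R, 0 <= v -> 0 <= phi v.
Hypothesis phi_concave : concave_on `[0, +oo[ phi.
Hypothesis phi_incr : forall u v : R, 0 <= u -> u < v -> phi u < phi v.
Hypothesis delta_gt0 : 0 < delta.

Lemma phi_gt0 v : 0 < v -> 0 < phi v.
Proof. by move=> v0; rewrite (le_lt_trans (phi_ge0 (lexx 0)))// phi_incr. Qed.

Lemma phi_le u v : 0 <= u -> u <= v -> phi u <= phi v.
Proof.
by move=> u0; rewrite le_eqVlt => /predU1P[->//|uv]; exact/ltW/phi_incr.
Qed.

(** A concave function that is nonnegative at 0 is star-shaped about 0. *)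
Lemma concave_scale a w : 0 <= a <= 1 -> 0 <= w -> a * phi w <= phi (a * w).
Proof.
move=> /andP[a0 a1] w0.
have [i ia] : exists i : {i01 R}, i%:num = a.
  by exists (Itv01 a0 a1).
have := @phi_concave i w 0.
rewrite !inE /= !in_itv/= lexx w0 => /(_ isT isT).
rewrite [X in - phi X](_ : _ = a * w); last first.
  by apply: etrans (convRE _ _ _) _; rewrite ia mulr0 addr0.
rewrite convRE ia (_ : unstable.onem a = 1 - a)// !mulrN => h.
have h0 : 0 <= (1 - a) * phi 0.
  by rewrite mulr_ge0 ?phi_ge0 ?subr_ge0.
lra.
Qed.

Lemma concave_subadditive u v : 0 <= u -> 0 <= v -> phi (u + v) <= phi u + phi v.
Proof.
move=> u0 v0; have [uv0|uv0] := leP (u + v) 0.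
  have -> : u = 0 by lra.
  by rewrite add0r lerDr phi_ge0.
have frac x : 0 <= x -> x <= u + v -> x / (u + v) * phi (u + v) <= phi x.
  move=> x0 xuv.
  have {2}-> : x = x / (u + v) * (u + v) by rewrite divfK// gt_eqF.
  apply: concave_scale; last exact: ltW.
  by rewrite divr_ge0 ?(ltW uv0)//= ler_pdivrMr// mul1r.
have := frac u u0; have := frac v v0.
rewrite lerDl lerDr u0 v0 => /(_ isT) hv /(_ isT) hu.
apply: le_trans (lerD hu hv).
by rewrite -!mulrDl divff ?mul1r// gt_eqF.
Qed.

Lemma concave_le_linear w : 1 <= w -> phi w <= w * phi 1.
Proof.
move=> w1; have w0 : 0 < w by exact: lt_le_trans w1.
have := @concave_scale w^-1 w; rewrite mulVf ?gt_eqF// invr_ge0 ltW// invf_le1//.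
by rewrite w1 => /(_ isT isT); rewrite mulrC ler_pdivrMr// mulrC.
Qed.

Let slope v := (delta * phi v)^-1.

Let slope_ge0 v : 0 <= v -> 0 <= slope v.
Proof. by move=> v0; rewrite invr_ge0 mulr_ge0 ?phi_ge0// ltW. Qed.

Let slope_le u v : 0 < u -> u <= v -> slope v <= slope u.
Proof.
move=> u0 uv; have v0 := lt_le_trans u0 uv.
rewrite /slope lef_pV2 ?posrE ?mulr_gt0 ?phi_gt0// ler_pM2l//.
exact: phi_le (ltW u0) uv.
Qed.

Let slope_integrable w :
  (@lebesgue_measure R).-integrable `[1, w] (EFin \o slope).
Proof.
pose g v := slope (Num.max v 1).
have mg : measurable_fun setT g.
  apply: nonincreasing_measurable => // u v uv; apply: slope_le.
    by rewrite lt_max ltr01 orbT.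
  by rewrite ge_max !le_max uv lexx !orbT.
apply: measurable_bounded_integrable => //.
- by rewrite /= lebesgue_measure_itv/=; case: ifP => // _; rewrite ltry.
- apply: (eq_measurable_fun g); last exact: measurable_funTS.
  move=> v; rewrite inE/= in_itv/= => /andP[v1 _]; rewrite /g.
  by rewrite (max_idPl v1).
- exists (slope 1); split; first exact: num_real.
  move=> M /ltW M1 v /=; rewrite in_itv/= => /andP[v1 _].
  rewrite ger0_norm ?slope_ge0 ?(le_trans _ v1)//.
  exact: le_trans (slope_le _ v1) M1.
Qed.

Let H := H1 delta phi.

(** The slope of [H] decreases, so its values at the two ends of an interval frame
the mean slope; this replaces differentiation throughout. *)
Lemma H1_increment u w : 1 <= u -> u <= w ->
  (w - u) * (delta * phi w)^-1 <= H w - H u <= (w - u) * (delta * phi u)^-1.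
Proof.
move=> u1 uw.
rewrite /H /H1 Rintegral_itvB ?slope_integrable//.
have mE : (@lebesgue_measure R) `]u, w] = (w - u)%:E.
  rewrite lebesgue_measure_itv/= lte_fin.
  move: uw; rewrite le_eqVlt => /predU1P[->|->//].
  by rewrite ltxx subrr.
have cstE c : \int[lebesgue_measure]_(v in `]u, w]) c = (w - u) * c.
  by rewrite Rintegral_cst// [X in fine X](_ : _ = (w - u)%:E)//= mulrC.
have int_slope : (@lebesgue_measure R).-integrable `]u, w] (EFin \o slope).
  apply: integrableS (slope_integrable w) => //.
  by move=> v /=; rewrite !in_itv/= => /andP[uv ->]; rewrite (le_trans u1 (ltW uv)).
have int_cst c : (@lebesgue_measure R).-integrable `]u, w] (EFin \o cst c).
  apply: measurable_bounded_integrable => //.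
    by rewrite [ltLHS](_ : _ = (w - u)%:E)// ltry.
  exact: bounded_cst.
rewrite -!cstE; apply/andP; split; apply: le_Rintegral => //;
  [exact: int_cst| |exact: int_cst|]; move=> v /=; rewrite in_itv/= => /andP[uv vw].
- by apply: slope_le => //; rewrite (lt_le_trans ltr01)// (le_trans u1)// ltW.
- by apply: slope_le => //; [exact: lt_le_trans ltr01 u1| exact: ltW].
Qed.

Lemma H1_at1 : H 1 = 0.
Proof. by rewrite /H /H1 set_itv1 Rintegral_set1. Qed.

Lemma H1_lt u w : 1 <= u -> u < w -> H u < H w.
Proof.
move=> u1 uw; have /andP[+ _] := H1_increment u1 (ltW uw).
rewrite -(subr_gt0 (H u)); apply: lt_le_trans.
rewrite mulr_gt0 ?subr_gt0// invr_gt0 mulr_gt0// phi_gt0//.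
by rewrite (lt_trans _ uw)// (lt_le_trans _ u1).
Qed.

Lemma H1_le u w : 1 <= u -> u <= w -> H u <= H w.
Proof.
by move=> u1; rewrite le_eqVlt => /predU1P[->//|uw]; exact/ltW/H1_lt.
Qed.

Lemma H1_ge0 w : 1 <= w -> 0 <= H w.
Proof. by move=> w1; rewrite -H1_at1 H1_le. Qed.

(** The tangent at [w0] has the slope of [H] at [w0], which is an upper bound of
the slopes on the right and a lower bound of those on the left. *)
Lemma H1_tangent w0 w : 1 <= w0 -> 1 <= w ->
  H w <= H w0 + (w - w0) * (delta * phi w0)^-1.
Proof.
move=> w01 w1; have [ww0|w0w] := leP w w0.
  have /andP[+ _] := H1_increment w1 ww0; lra.
have /andP[_ +] := H1_increment w01 (ltW w0w); lra.
Qed.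

(** Since [phi] grows at most linearly, [H] grows at least logarithmically: every
doubling of the argument adds at least a fixed amount. *)
Lemma H1_unbounded b : exists2 w, 1 <= w & b <= H w.
Proof.
pose c := (2 * (delta * phi 1))^-1.
have c0 : 0 < c by rewrite invr_gt0 !mulr_gt0// phi_gt0.
have dbl w : 1 <= w -> H w + c <= H (2 * w).
  move=> w1; have w0 : 0 < w by exact: lt_le_trans w1.
  have w2 : w <= 2 * w by lra.
  have /andP[+ _] := H1_increment w1 w2.
  suff : c <= (2 * w - w) * (delta * phi (2 * w))^-1 by lra.
  rewrite /c (_ : 2 * w - w = w); last by lra.
  rewrite ler_pdivlMr ?ler_pdivrMl ?mulr_gt0 ?phi_gt0 ?mulr_gt0//.
  have := @concave_le_linear (2 * w); rewrite (le_trans w1)// => /(_ isT) h.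
  rewrite (_ : 2 * _ * w = delta * (2 * w * phi 1)); last by ring.
  by rewrite ler_pM2l.
have grow n : c * n%:R <= H (2 ^+ n) /\ 1 <= 2 ^+ n :> R.
  elim: n => [|n [ih ih1]]; first by rewrite mulr0 expr0 H1_at1.
  by rewrite exprS; have := dbl _ ih1; rewrite -natr1; split; lra.
have [w1 wb] := grow (Num.truncn (b / c)).+1.
exists (2 ^+ (Num.truncn (b / c)).+1) => //.
apply: le_trans w1; rewrite mulrC -ler_pdivrMr//.
exact/ltW/truncnS_gt.
Qed.

Lemma H1_onto u : 0 <= u -> exists2 w, 1 <= w & H w = u.
Proof.
move=> u0; have [b b1 ub] := H1_unbounded u.
(* [H] is extended by a constant below 1 to have a function that is Lipschitz
   on the whole line. *)
pose f (x : R) := H (Num.max x 1).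
have max1 (x : R) : 1 <= Num.max x 1 by rewrite le_max lexx orbT.
have lip (x y : R) : `|f x - f y| <= slope 1 * `|x - y|.
  wlog xy : x y / x <= y.
    move=> hw; have [|/ltW] := leP x y; first exact: hw.
    by rewrite distrC (distrC x); exact: hw.
  have mxy : Num.max x 1 <= Num.max y 1 by rewrite ge_max !le_max xy lexx !orbT.
  have /andP[_ h] := H1_increment (max1 x) mxy.
  rewrite distrC (distrC x) !ger0_norm ?subr_ge0 ?H1_le//.
  apply: le_trans h _; rewrite mulrC; apply: ler_pM.
  - by rewrite invr_ge0 mulr_ge0 ?phi_ge0 ?(ltW delta_gt0) ?(le_trans _ (max1 x)).
  - by rewrite subr_ge0.
  - by apply: slope_le.
  - by rewrite /Num.max; case: ifPn; case: ifPn; lra.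
have f_cont : continuous f.
  move=> x; apply/cvgrPdist_lt => e e0.
  have s0 : 0 < slope 1 by rewrite invr_gt0 mulr_gt0// phi_gt0.
  near=> y; apply: le_lt_trans (lip x y) _.
  rewrite -ltr_pdivlMl//.
  near: y; apply: (@cvgr_dist_lt _ _ _ _ _ id) => //.
  by rewrite mulr_gt0// invr_gt0.
have [w /[!in_itv]/= /andP[w1 _] fw] : exists2 w, w \in `[1, b] & f w = u.
  apply: IVT => //; first exact: continuous_subspaceT.
  rewrite /f maxxx H1_at1 (max_idPl b1) min_l ?max_r ?u0 ?ub//.
    exact: le_trans ub.
  exact: le_trans ub.
by exists w => //; rewrite -fw /f (max_idPl w1).
Unshelve. all: by end_near.
Qed.

Lemma H1_invK u : 0 <= u -> H (H1_inv delta phi u) = u.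
Proof.
move=> u0; apply: pinvK; rewrite inE /=.
by have [w w1 Hw] := H1_onto u0; exists w => //=; rewrite in_itv/= w1.
Qed.

Lemma H1_inv_ge1 u : 0 <= u -> 1 <= H1_inv delta phi u.
Proof.
move=> u0; have [w w1 <-] := H1_onto u0.
rewrite /H1_inv pinvKV ?inE/= ?in_itv/= ?w1//.
move=> x y; rewrite !inE/= !in_itv/= !andbT => x1 y1.
have [/(H1_lt x1)|/(H1_lt y1)|//] := ltgtP x y => + e; rewrite /H in e *.
  by rewrite e ltxx.
by rewrite e ltxx.
Qed.

Lemma H1_inv_gt u b : 1 <= b -> H b < u -> b < H1_inv delta phi u.
Proof.
move=> b1 bu; have u0 : 0 <= u by rewrite (le_trans (H1_ge0 b1))// ltW.
rewrite ltNge; apply/negP => /(H1_le (H1_inv_ge1 u0)).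
by rewrite H1_invK// leNgt bu.
Qed.

Lemma H1_inv_le u v : 0 <= u -> u <= v -> H1_inv delta phi u <= H1_inv delta phi v.
Proof.
move=> u0 uv; have v0 := le_trans u0 uv.
rewrite leNgt; apply/negP => /(H1_lt (H1_inv_ge1 v0)).
by rewrite !H1_invK// ltNge uv.
Qed.

Lemma rate_ratio_ge1 : 1 <= rate delta phi 1 / rate delta phi 0.
Proof.
have pos : 0 < phi (H1_inv delta phi 0).
  by rewrite phi_gt0// (lt_le_trans ltr01)// H1_inv_ge1.
rewrite /rate ler_pdivlMr ?mulr_gt0// mul1r ler_pM2l// phi_le//.
  by rewrite (le_trans ler01)// H1_inv_ge1.
by rewrite H1_inv_le.
Qed.

End drift_clock.

(** * Kernels, mixtures and conditional laws *)

Section precomposition.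
Context d1 d2 d3 (S : measurableType d1) (U : measurableType d2)
  (T : measurableType d3) (R : realType).
Variables (g : S -> U) (k : R.-pker U ~> T).

Definition kernel_precomp of measurable_fun setT g :
  S -> {measure set T -> \bar R} := fun s => k (g s).

Hypothesis mg : measurable_fun setT g.

Let kernel_precomp_measurable B : measurable B ->
  measurable_fun setT (kernel_precomp mg ^~ B).
Proof. by move=> mB; exact: measurableT_comp (measurable_kernel k B mB) mg. Qed.

HB.instance Definition _ :=
  isKernel.Build _ _ S T R (kernel_precomp mg) kernel_precomp_measurable.

Let kernel_precomp_prob s : kernel_precomp mg s setT = 1%E.
Proof. exact: prob_kernel. Qed.

HB.instance Definition _ :=
  Kernel_isProbability.Build _ _ S T R (kernel_precomp mg) kernel_precomp_prob.

End precomposition.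

Section kernel_law.
Context d2 d3 (U : measurableType d2) (T : measurableType d3) (R : realType).
Variables (k : R.-pker U ~> T) (u : U).

(** The measure [k u] with its structure of probability, which couplings and
distributions need. *)
Definition kernel_law : set T -> \bar R := k u.

HB.instance Definition _ := Measure.copy kernel_law (k u).

Let kernel_law_setT : kernel_law setT = 1%E.
Proof. exact: prob_kernel. Qed.

HB.instance Definition _ :=
  Measure_isProbability.Build _ _ _ kernel_law kernel_law_setT.

End kernel_law.

Section graph_kernel.
Context d1 d2 d3 (S : measurableType d1) (U : measurableType d2)
  (T : measurableType d3) (R : realType).

Let pairing (u : U) (y : T) : U * T := (u, y).

HB.instance Definition _ u :=
  isMeasurableFun.Build _ _ _ _ (pairing u) (measurable_pair1 u).

Variables (Z : S -> U) (k : R.-pker U ~> T).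

(** The joint law of [Z s] and of a point drawn from [k (Z s)]: a function of both
then becomes a function on the target space of a single kernel. *)
Definition kernel_graph of measurable_fun setT Z :
    S -> {measure set (U * T) -> \bar R} :=
  fun s => distribution (kernel_law k (Z s)) (pairing (Z s)).

Hypothesis mZ : measurable_fun setT Z.

Let kernel_graph_measurable B : measurable B ->
  measurable_fun setT (kernel_graph mZ ^~ B).
Proof.
move=> mB; have h := measurable_fun_xsection_finite_kernel k (mem_set mB).
rewrite (_ : kernel_graph mZ ^~ B = (fun u => k u (xsection B u)) \o Z).
  exact: measurableT_comp h mZ.
by apply/funext => s /=; rewrite xsectionE.
Qed.

HB.instance Definition _ :=
  isKernel.Build _ _ S _ R (kernel_graph mZ) kernel_graph_measurable.

Let kernel_graph_prob s : kernel_graph mZ s setT = 1%E.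
Proof. exact: probability_setT. Qed.

HB.instance Definition _ :=
  Kernel_isProbability.Build _ _ S _ R (kernel_graph mZ) kernel_graph_prob.

Lemma integral_kernel_graph s (f : U * T -> \bar R) :
  (forall z, 0 <= f z)%E -> measurable_fun setT f ->
  (\int[kernel_graph mZ s]_z f z = \int[k (Z s)]_y f (Z s, y))%E.
Proof. by move=> f0 mf; rewrite ge0_integral_distribution. Qed.

End graph_kernel.

Section mixtures.
Context d d' (Om : measurableType d) (T : measurableType d') (R : realType).
Variables (Pr : probability Om R) (rho : probability T R)
  (k : R.-pker Om ~> T).

(** A probability that agrees on a generating pi-system with the mixture of the
kernel [k] under [Pr] is that mixture. It serves twice: for invariant laws, and
for the joint law of a variable and of its conditioning variable. *)
Lemma integral_mixture (G : set (set T)) :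
  measurable = <<s G >> -> setI_closed G -> G setT ->
  (forall B, G B -> rho B = \int[Pr]_w k w B)%E ->
  forall f : T -> \bar R, (forall z, 0 <= f z)%E -> measurable_fun setT f ->
  (\int[rho]_z f z = \int[Pr]_w \int[k w]_z f z)%E.
Proof.
move=> mG GI GT rhoE f f0 mf.
(* The mixture is the composition of [k] with the constant kernel [Pr], for
   which integrals are already known to be iterated integrals. *)
pose l : R.-pker unit ~> Om :=
  kprobability (measurable_cst (Pr : pprobability Om R)).
have msnd : measurable_fun setT (snd : unit * Om -> Om) by [].
pose k2 : R.-pker (unit * Om)%type ~> T := kernel_precomp k msnd.
rewrite (eq_measure_integral (kcomp l k2 tt)).
  exact: integral_kcomp.
move=> A mA _; apply: (measure_unique G (fun=> setT)) => //.
- by rewrite bigcup_const.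
- by move=> _; rewrite [ltLHS](probability_setT rho) ltry.
Qed.

End mixtures.

Section conditional_laws.
Context d d1 d2 (Om : measurableType d) (U : measurableType d1)
  (T : measurableType d2) (R : realType).
Variables (Pr : probability Om R) (Z : Om -> U) (W : Om -> T).
Hypotheses (mZ : measurable_fun setT Z) (mW : measurable_fun setT W).

(** From the rectangles in the definition of a conditional law to all nonnegative
functions of the pair. *)
Lemma cond_law_integral (k : R.-pker U ~> T) : cond_law Pr Z W k ->
  forall f : U * T -> \bar R, (forall z, 0 <= f z)%E -> measurable_fun setT f ->
  (\int[Pr]_w f (Z w, W w) = \int[Pr]_w \int[k (Z w)]_y f (Z w, y))%E.
Proof.
move=> kZW f f0 mf.
have mZW : measurable_fun setT (fun w => (Z w, W w)) by exact: measurable_fun_pair.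
pose ZW : {mfun Om >-> (U * T)%type} :=
  HB.pack (fun w => (Z w, W w)) (isMeasurableFun.Build _ _ _ _ _ mZW).
rewrite -[LHS](ge0_integral_pushforward mZW Pr measurableT mf)//.
under [RHS]eq_integral do rewrite -(integral_kernel_graph k mZ _ f0 mf).
apply: (@integral_mixture _ _ _ _ _ Pr (distribution Pr ZW) (kernel_graph k mZ)
  _ (measurable_prod_measurableType U T)) => //.
- move=> _ _ [A mA [B mB <-]] [A' mA' [B' mB' <-]].
  exists (A `&` A'); first exact: measurableI.
  by exists (B `&` B'); [exact: measurableI|rewrite setXI].
- by exists setT => //; exists setT => //; rewrite setXTT.
- move=> _ [A mA [B mB <-]].
  apply: (etrans (kZW A B mA mB)); rewrite [LHS]integral_mkcond.
  apply: eq_integral => w _; rewrite patchE.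
  transitivity (k (Z w) [set y | A (Z w) /\ B y]); last by [].
  case: ifPn => [/set_mem Aw|/negP Aw].
    by congr (k _ _); apply/seteqP; split => [y|y []].
  rewrite (_ : [set y | _] = set0) ?measure0//.
  by apply/seteqP; split => // y [] /mem_set.
Qed.

End conditional_laws.

(** * The chain with a frozen parameter *)

(** Averages of functions with values in [0, 1] are kept real-valued, so that they
can be subtracted; these lemmas relate them to extended-real integrals. *)
Section kernel_averages.
Context d d' (U : measurableType d) (T : measurableType d') (R : realType).
Variables (k : R.-pker U ~> T) (h : U * T -> R).
Hypotheses (mh : measurable_fun setT h) (h01 : forall z, 0 <= h z <= 1).

Let section_measurable u : measurable_fun setT (fun y => h (u, y)).
Proof. exact: measurableT_comp mh (measurable_pair1 u). Qed.

Lemma kernel_average_fin u :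
  (\int[k u]_y h (u, y))%:E = (\int[k u]_y (h (u, y))%:E)%E.
Proof.
rewrite /Rintegral fineK//; apply: integrable_fin_num => //.
exact: (bounded01_integrable (kernel_law k u)).
Qed.

Lemma kernel_average01 u : 0 <= \int[k u]_y h (u, y) <= 1.
Proof.
rewrite -!lee_fin kernel_average_fin; apply/andP; split.
  by apply: integral_ge0 => y _; rewrite lee_fin; have /andP[] := h01 (u, y).
rewrite -[leRHS](probability_setT (kernel_law k u)) -[leRHS]mul1e -integral_cst//.
apply: ge0_le_integral => //.
- by move=> y _; rewrite lee_fin; have /andP[] := h01 (u, y).
- exact/measurable_EFinP.
- by move=> y _; rewrite lee_fin; have /andP[] := h01 (u, y).
Qed.

Lemma kernel_average_measurable :
  measurable_fun setT (fun u => \int[k u]_y h (u, y)).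
Proof.
apply/measurable_EFinP.
rewrite [X in measurable_fun _ X](_ : _ = fun u => (\int[k u]_y (h (u, y))%:E)%E).
  apply: (measurable_fun_integral_finite_kernel (EFin \o h)).
    by move=> z; rewrite lee_fin; have /andP[] := h01 z.
  exact/measurable_EFinP.
by apply/funext => u; exact: kernel_average_fin.
Qed.

End kernel_averages.

Section propagation.
Context dX dY (X : measurableType dX) (Y : measurableType dY) (R : realType).
Variables (P : R.-pker (X * Y) ~> X) (f : X -> R).
Hypotheses (mf : measurable_fun setT f) (f01 : forall x, 0 <= f x <= 1).

(** With [z = (x, g)], this is the n-step expectation $P_g^n f(x)$ of the chain
whose parameter stays equal to [g]. *)
Fixpoint propagate (n : nat) (z : X * Y) : R :=
  if n is n'.+1 then \int[P z]_y propagate n' (y, z.2) else f z.1.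

Lemma propagateS n z : propagate n.+1 z = \int[P z]_y propagate n (y, z.2).
Proof. by []. Qed.

Let next_state (z : (X * Y) * X) := (z.2, z.1.2).

Let next_state_measurable : measurable_fun setT next_state.
Proof.
apply: measurable_fun_pair => //=.
exact: measurableT_comp measurable_snd measurable_fst.
Qed.

Lemma propagate01 n z : 0 <= propagate n z <= 1.
Proof.
suff [] : (forall z, 0 <= propagate n z <= 1) /\
  measurable_fun setT (propagate n) by move=> ->.
elim: n {z} => [|n [ih01 ihm]].
  by split=> [z|] //=; exact: measurableT_comp mf measurable_fst.
have m' := measurableT_comp ihm next_state_measurable.
split=> [z|].
  apply: (@kernel_average01 _ _ _ _ _ P (propagate n \o next_state)) => // u.
  exact: ih01.
apply: (@kernel_average_measurable _ _ _ _ _ P (propagate n \o next_state)) => //.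
by move=> u; exact: ih01.
Qed.

Lemma propagate_measurable n : measurable_fun setT (propagate n).
Proof.
elim: n => [|n ihm]; first exact: measurableT_comp mf measurable_fst.
apply: (@kernel_average_measurable _ _ _ _ _ P (propagate n \o next_state)) => //.
  exact: measurableT_comp ihm next_state_measurable.
by move=> z; exact: propagate01.
Qed.

Lemma propagate_fin n z :
  (propagate n.+1 z)%:E = (\int[P z]_y (propagate n (y, z.2))%:E)%E.
Proof.
apply: (@kernel_average_fin _ _ _ _ _ P (propagate n \o next_state)) => //.
  exact: measurableT_comp (propagate_measurable n) next_state_measurable.
by move=> u; exact: propagate01.
Qed.

Lemma propagate_stationary (pi : probability X R) (g : Y) :
  (forall A, measurable A -> \int[pi]_x P (x, g) A = pi A)%E ->
  forall n, (\int[pi]_x (propagate n (x, g))%:E = \int[pi]_x (f x)%:E)%E.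
Proof.
move=> inv; elim=> [//|n <-].
under eq_integral do rewrite propagate_fin.
rewrite /=; apply/esym.
have mg : measurable_fun setT (fun x : X => (x, g)) by exact: measurable_pair2.
apply: (@integral_mixture _ _ _ _ _ pi pi (kernel_precomp P mg) measurable) => //.
- by rewrite sigma_algebra_id//; exact: sigma_algebra_measurable.
- by move=> A B; exact: measurableI.
- by move=> A mA; exact/esym/inv.
- by move=> x; rewrite lee_fin; have /andP[] := propagate01 n (x, g).
- apply/measurable_EFinP.
  exact: measurableT_comp (propagate_measurable n) mg.
Qed.

End propagation.

Section frozen_chain.
Context dX dY (X : measurableType dX) (Y : measurableType dY) (R : realType).
Variables (P : R.-pker (X * Y) ~> X).
Hypothesis mdiag : measurable [set z : X * X | z.1 <> z.2].
Variables (V : X -> R) (phi : R -> R) (K delta alpha : R).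
Hypotheses (V_meas : measurable_fun setT V) (V_ge1 : forall x, 1 <= V x).
Hypothesis phi_ge0 : forall v : R, 0 <= v -> 0 <= phi v.
Hypothesis phi_concave : concave_on `[0, +oo[ phi.
Hypothesis phi_incr : forall u v : R, 0 <= u -> u < v -> phi u < phi v.
Hypothesis phi_infty : phi v @[v --> +oo] --> +oo.
Hypotheses (K_ge0 : 0 <= K) (delta01 : 0 < delta < 1) (alpha01 : 0 < alpha < 1).
Hypothesis drift : forall x g,
  (\int[P (x, g)]_y (V y)%:E - (V x)%:E <= (- phi (V x) + K)%:E)%E.
Hypothesis contraction : forall x y g,
  V x + V y <= phi_inv phi (2 * K / (1 - delta)) ->
  (tv (P (x, g)) (P (y, g)) <= (1 - alpha)%:E)%E.

Let delta_gt0 : 0 < delta. Proof. by case/andP: delta01. Qed.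
Let H := H1 delta phi.

Lemma drift_integral_le x g :
  (\int[P (x, g)]_y (V y)%:E <= (V x - phi (V x) + K)%:E)%E.
Proof. by have := drift x g; rewrite leeBlDr// -EFinD addrAC [- _ + _]addrC. Qed.

Lemma drift_integrable z : (P z).-integrable setT (EFin \o V).
Proof.
apply: nonneg_integrable => // [x|]; first by rewrite (le_trans ler01).
by case: z => x g; exact: le_lt_trans (drift_integral_le x g) (ltry _).
Qed.

Lemma drift_Rintegral_le x g :
  \int[P (x, g)]_y V y <= V x - phi (V x) + K.
Proof.
rewrite -lee_fin /Rintegral fineK ?drift_integral_le//.
exact: integrable_fin_num (drift_integrable (x, g)).
Qed.

(** The drift of the two copies taken together, as a function of the sum alone: the
concave function [phi] is subadditive. *)
Lemma pair_drift x y g :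
  \int[P (x, g)]_z V z + \int[P (y, g)]_z V z - (V x + V y) <=
  - phi (V x + V y) + 2 * K.
Proof.
have h1 := drift_Rintegral_le x g; have h2 := drift_Rintegral_le y g.
have V0 z : 0 <= V z by exact: le_trans (V_ge1 z).
have := concave_subadditive phi_ge0 phi_concave (V0 x) (V0 y).
lra.
Qed.

(** Outside the contraction set the drift [- phi + 2 * K] is at most
[- delta * phi]. *)
Lemma phi_above_threshold w : phi_inv phi (2 * K / (1 - delta)) < w ->
  2 * K <= (1 - delta) * phi w.
Proof.
move=> /inf_lt[].
  move/cvgryPge : phi_infty => /(_ (2 * K / (1 - delta))) [M [_ hM]].
  exists (Num.max 0 (M + 1)); split; first by rewrite le_max lexx.
  by apply: hM; rewrite lt_max ltrDl ltr01 orbT.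
move=> v [v0 hv] vw; have d1 : 0 < 1 - delta by rewrite subr_gt0; case/andP: delta01.
rewrite [leRHS]mulrC -ler_pdivrMr//; apply: (le_trans hv).
exact/ltW/phi_incr.
Qed.

Section coupling_time.
Variable f : X -> R.
Hypotheses (mf : measurable_fun setT f) (f01 : forall x, 0 <= f x <= 1).
Let F := propagate P f.

(* A bound for the mean increase of [H (V x + V y)] in one step from the
   contraction set, where the slope of [H] is at most its slope at 1. *)
Let bump := 2 * K / (delta * phi 1).
(** The level, in units of [c], below which the maximum in [propagate_gap_step]
need not decrease: at this level, the fraction [alpha] gained on the contraction
set still pays for [bump + 1]. *)
Definition coupling_lag := (bump + 1) / alpha.

Lemma coupling_lag_ge0 : 0 <= coupling_lag.
Proof.
rewrite divr_ge0 ?addr_ge0 ?divr_ge0 ?mulr_ge0 ?phi_ge0 ?(ltW delta_gt0)//.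
by case/andP: alpha01 => /ltW.
Qed.

(** The term [c * H] is a reserve. Outside the contraction set any coupling will
do, because the reserve decreases by [c] in the mean; inside, the reserve may
increase by [c * bump], and the coupling multiplies the maximum by
[1 - alpha]. In both cases the total decreases as the maximum does. *)
Lemma propagate_gap_step (c : R) n x y g :
  0 < c ->
  (forall x y, F n (x, g) - F n (y, g) <=
    Num.max (1 - c * n%:R) (c * coupling_lag) + c * H (V x + V y)) ->
  F n.+1 (x, g) - F n.+1 (y, g) <=
    Num.max (1 - c * n.+1%:R) (c * coupling_lag) + c * H (V x + V y).
Proof.
move=> c0 ih; set a := Num.max _ _ in ih.
have phi1 : 0 < phi 1 by exact: phi_gt0.
have alpha0 : 0 < alpha by case/andP: alpha01.
have bump0 : 0 <= bump by rewrite /bump divr_ge0 ?mulr_ge0 ?phi_ge0 ?(ltW delta_gt0).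
have lag0 := coupling_lag_ge0.
have a0 : 0 <= a by rewrite le_max (mulr_ge0 (ltW c0) lag0) orbT.
have sum1 u v : 1 <= V u + V v.
  by have := V_ge1 u; have := V_ge1 v; lra.
pose w0 := V x + V y; pose s := (delta * phi w0)^-1.
have w01 : 1 <= w0 by exact: sum1.
have phiw0 : phi 1 <= phi w0 by exact: phi_le.
have phiw0_gt0 : 0 < phi w0 by exact: lt_le_trans phiw0.
have s0 : 0 < s by rewrite invr_gt0 mulr_gt0.
pose mV := \int[P (x, g)]_z V z + \int[P (y, g)]_z V z.
have gap th : (tv (P (x, g)) (P (y, g)) <= th%:E)%E ->
    F n.+1 (x, g) - F n.+1 (y, g) <= a * th + c * H w0 + c * (s * (mV - w0)).
  move=> tvth.
  have -> : a * th + c * H w0 + c * (s * (mV - w0)) =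
    a * th + c * (H w0 - w0 * s) + c * s * mV by ring.
  apply: (tv_transport mdiag (mu := kernel_law P (x, g))
    (nu := kernel_law P (y, g)) (f := fun z => F n (z, g)) (V := V)) => //.
  - exact: measurableT_comp (propagate_measurable P mf f01 n) (measurable_pair2 g).
  - by move=> z; exact: propagate01.
  - exact: drift_integrable.
  - exact: drift_integrable.
  - (* On the diagonal the left-hand side vanishes and the indicator with it;
       the tangent bound is still nonnegative there. *)
    move=> u v; have [<-|uv] := pselect (u = v).
      rewrite indicE memNset ?mulr0 ?add0r; last by move=> /(_ erefl).
      rewrite subrr.
      have := H1_tangent phi_ge0 phi_incr delta_gt0 w01 (sum1 u u).
      have := H1_ge0 phi_ge0 phi_incr delta_gt0 (sum1 u u).
      rewrite -/H -/s => h0 h1.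
      have : 0 <= c * (H w0 + (V u + V u - w0) * s).
        by rewrite mulr_ge0 ?(ltW c0)// (le_trans h0).
      lra.
    rewrite indicE mem_set//= mulr1; apply: le_trans (ih u v) _.
    have := H1_tangent phi_ge0 phi_incr delta_gt0 w01 (sum1 u v).
    rewrite -/H -/s => h1.
    have : c * H (V u + V v) <= c * (H w0 + (V u + V v - w0) * s).
      by rewrite ler_pM2l.
    lra.
rewrite -/w0.
have pd : mV - w0 <= - phi w0 + 2 * K by exact: pair_drift.
have aS : a - c <= Num.max (1 - c * n.+1%:R) (c * coupling_lag).
  rewrite lerBlDr /a ge_max -natr1; apply/andP; split.
    rewrite -lerBlDr le_max; apply/orP; left; lra.
  by rewrite ler_wpDr ?(ltW c0)// le_max lexx orbT.
have [inS|outS] := leP w0 (phi_inv phi (2 * K / (1 - delta))).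
  have drift_le : s * (mV - w0) <= bump.
    apply: (@le_trans _ _ (s * (2 * K))).
      by rewrite ler_pM2l//; lra.
    rewrite /bump mulrC ler_wpM2l ?mulr_ge0//.
    by rewrite lef_pV2 ?posrE ?mulr_gt0// ler_pM2l.
  have a_lag : c * (bump + 1) <= a * alpha.
    rewrite -ler_pdivrMr// -mulrA.
    by rewrite /a le_max lexx orbT.
  have cs : c * (s * (mV - w0)) <= c * bump by rewrite ler_pM2l.
  have := gap _ (contraction g inS); lra.
have s_drift : s * (mV - w0) <= - 1.
  apply: (@le_trans _ _ (s * - (delta * phi w0))).
    rewrite ler_pM2l//; have := phi_above_threshold outS; lra.
  by rewrite mulrN mulVf// gt_eqF// mulr_gt0.
have cs : c * (s * (mV - w0)) <= c * - 1 by rewrite ler_pM2l.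
have := gap _ (tv_le1 mdiag (kernel_law P (x, g)) (kernel_law P (y, g))).
lra.
Qed.

(** For [c = 1 / t] and [n = t] the first term of the maximum vanishes. *)
Lemma propagate_gap_le t x y g : (0 < t)%N ->
  F t (x, g) - F t (y, g) <= (coupling_lag + H (V x + V y)) / t%:R.
Proof.
move=> t0; have t0' : 0 < t%:R :> R by rewrite ltr0n.
pose c : R := t%:R^-1; have c0 : 0 < c by rewrite invr_gt0.
have H0 u v : 0 <= H (V u + V v).
  apply: (H1_ge0 phi_ge0 phi_incr delta_gt0).
  by have := V_ge1 u; have := V_ge1 v; lra.
have gap n u v : F n (u, g) - F n (v, g) <=
    Num.max (1 - c * n%:R) (c * coupling_lag) + c * H (V u + V v).
  elim: n u v => [|n ih] u v; last exact: propagate_gap_step.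
  rewrite mulr0 subr0; apply: (@le_trans _ _ 1).
    have /andP[_ h1] := propagate01 P mf f01 0 (u, g).
    by have /andP[h0 _] := propagate01 P mf f01 0 (v, g); rewrite /F; lra.
  by rewrite ler_wpDr ?mulr_ge0 ?(ltW c0)// le_max lexx.
apply: le_trans (gap t x y) _.
have lag0 := coupling_lag_ge0.
rewrite /c mulVf ?gt_eqF// subrr max_r; last by rewrite mulr_ge0// ltW.
by rewrite -mulrDr mulrC.
Qed.

(** Linear in [V], hence integrable in [y] under a law for which only [V], and not
[H], is controlled: above the level [M] the bound 1 is at most
[(V x + V y) / M]. *)
Lemma propagate_gap_truncated t (M : R) x y g : (0 < t)%N -> 1 <= M ->
  F t (x, g) - F t (y, g) <=
    (coupling_lag + H M) / t%:R + (V x + V y) / M.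
Proof.
move=> t0 M1; have M0 : 0 < M by exact: lt_le_trans M1.
have V0 z : 0 <= V z by exact: le_trans (V_ge1 z).
have lag0 := coupling_lag_ge0.
have HM := H1_ge0 phi_ge0 phi_incr delta_gt0 M1.
have [VM|MV] := leP (V x + V y) M.
  apply: le_trans (propagate_gap_le x y g t0) _.
  apply: ler_wpDr; first by rewrite divr_ge0 ?addr_ge0// ltW.
  rewrite ler_wpM2r ?invr_ge0// lerD2l.
  apply: (H1_le phi_ge0 phi_incr delta_gt0) => //.
  by have := V_ge1 x; have := V0 y; lra.
apply: (@le_trans _ _ 1).
  have /andP[_ h1] := propagate01 P mf f01 t (x, g).
  by have /andP[h0 _] := propagate01 P mf f01 t (y, g); rewrite /F; lra.
apply: ler_wpDl; first by rewrite divr_ge0 ?addr_ge0.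
by rewrite ler_pdivlMr// mul1r ltW.
Qed.

(** An invariant law is a mean over [y] of the n-step laws from [y], so the gap
between two starting points can be integrated over the second one. *)
Lemma frozen_convergence (pi : probability X R) t (M : R) x g :
  (0 < t)%N -> 1 <= M -> pi.-integrable setT (EFin \o V) ->
  (forall A, measurable A -> \int[pi]_x P (x, g) A = pi A)%E ->
  F t (x, g) <= \int[pi]_x f x +
    (coupling_lag + H M) / t%:R + (V x + \int[pi]_y V y) / M.
Proof.
move=> t0 M1 piV inv.
have mFt : measurable_fun setT (fun y => F t (y, g)).
  exact: measurableT_comp (propagate_measurable P mf f01 t) (measurable_pair2 g).
have F01 y : 0 <= F t (y, g) <= 1 by exact: propagate01.
have piF := bounded01_integrable pi mFt F01.
have -> : \int[pi]_x f x = \int[pi]_y F t (y, g).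
  by rewrite /Rintegral /F propagate_stationary.
pose b := (coupling_lag + H M) / t%:R + V x / M.
have piVM : pi.-integrable setT (EFin \o (fun y => M^-1 * V y)).
  exact: (integrableZl measurableT M^-1 piV).
have piFb : pi.-integrable setT (EFin \o (fun y => F t (y, g) + b)).
  exact: (integrableD measurableT piF (probability_integrable_cst pi b)).
have : \int[pi]_y F t (x, g) <= \int[pi]_y (F t (y, g) + b + M^-1 * V y).
  apply: le_Rintegral => //.
  - exact: probability_integrable_cst.
  - exact: (integrableD measurableT piFb piVM).
  move=> y _; have := propagate_gap_truncated x y g t0 M1.
  rewrite /b (mulrDl (V x)); lra.
have -> : \int[pi]_y (F t (y, g) + b + M^-1 * V y) =
    \int[pi]_y F t (y, g) + b + M^-1 * \int[pi]_y V y.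
  rewrite (RintegralD measurableT piFb piVM).
  rewrite (RintegralD measurableT piF (probability_integrable_cst pi b)).
  by congr (_ + _ + _); [exact: probability_Rintegral_cst|exact: RintegralZl].
rewrite [leLHS]probability_Rintegral_cst /b (mulrDl (V x)); lra.
Qed.

End coupling_time.
End frozen_chain.

(** * The adaptive chain *)

Section adapted_chain.
Context dX dY (X : measurableType dX) (Y : measurableType dY) (R : realType).
Variables (P : R.-pker (X * Y) ~> X).
Context d (Om : measurableType d) (Pr : probability Om R).
Variables (Gam : nat -> {mfun Om >-> Y}) (Xi : nat -> {mfun Om >-> X}).

Let past n (w : Om) : n.+1.-tuple (Y * X) * Y :=
  (history Gam Xi n.+1 w, Gam n.+1 w).

Hypothesis step : forall n,
  cond_law Pr (past n) (Xi n.+1) (fun z => P ((tnth z.1 ord_max).2, z.2)).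

Let past_state n (i : nat) (z : n.+1.-tuple (Y * X) * Y) : X :=
  (tnth z.1 (inord i)).2.

(* In the past of step [n.+1], the parameters of index at most [n] are entries of
   the history, and the one of index [n.+1] is the second component. *)
Let past_param n (i : nat) (z : n.+1.-tuple (Y * X) * Y) : Y :=
  if (i <= n)%N then (tnth z.1 (inord i)).1 else z.2.

Let past_stateE n i w : (i <= n)%N -> past_state i (past n w) = Xi i w.
Proof. by move=> ni; rewrite /past_state tnth_mktuple inordK. Qed.

Let past_paramE n i w : (i <= n.+1)%N -> past_param i (past n w) = Gam i w.
Proof.
move=> ni; rewrite /past_param; case: ifPn => [ni'|].
  by rewrite tnth_mktuple inordK.
by rewrite -ltnNge => ni'; rewrite (_ : i = n.+1)//; apply/eqP; rewrite eqn_leq ni.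
Qed.

Let past_entry_measurable n (i : 'I_n.+1) :
  measurable_fun setT (fun z : n.+1.-tuple (Y * X) * Y => tnth z.1 i).
Proof. exact: measurableT_comp (measurable_tnth i) measurable_fst. Qed.

Let past_state_measurable n i : measurable_fun setT (@past_state n i).
Proof. exact: measurableT_comp measurable_snd (past_entry_measurable _). Qed.

Let past_param_measurable n i : measurable_fun setT (@past_param n i).
Proof.
rewrite /past_param; case: (i <= n)%N; last exact: measurable_snd.
exact: measurableT_comp measurable_fst (past_entry_measurable _).
Qed.

Let past_measurable n : measurable_fun setT (past n).
Proof.
apply: measurable_fun_pair => //; apply/measurable_fun_tnthP => i.
rewrite [X in measurable_fun _ X](_ : _ = fun w => (Gam i w, Xi i w)).
  exact: measurable_fun_pair.
by apply/funext => w /=; rewrite tnth_mktuple.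
Qed.

Let move_args n (z : n.+1.-tuple (Y * X) * Y) := ((tnth z.1 ord_max).2, z.2).

Let move_args_measurable n : measurable_fun setT (@move_args n).
Proof.
apply: measurable_fun_pair => //.
exact: measurableT_comp measurable_snd (past_entry_measurable _).
Qed.

Let move_argsE n w : move_args (past n w) = (Xi n w, Gam n.+1 w).
Proof. by rewrite /move_args tnth_mktuple. Qed.

Lemma step_integral n (f : (n.+1.-tuple (Y * X) * Y) * X -> \bar R) :
  (forall z, 0 <= f z)%E -> measurable_fun setT f ->
  (\int[Pr]_w f (past n w, Xi n.+1 w) =
   \int[Pr]_w \int[P (Xi n w, Gam n.+1 w)]_y f (past n w, y))%E.
Proof.
move=> f0 mf.
rewrite (cond_law_integral (@past_measurable n) (measurable_funPT (Xi n.+1))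
  (k := kernel_precomp P (@move_args_measurable n)) (@step n) f0 mf).
by apply: eq_integral => w _; rewrite -move_argsE.
Qed.

(** The drift bound is uniform in the parameter, so it survives the adaptive choice
of the parameter and the means add up. *)
Lemma mean_drift (V : X -> R) (K : R) :
  measurable_fun setT V -> (forall x, 0 <= V x) -> 0 <= K ->
  (forall x g, \int[P (x, g)]_y (V y)%:E <= (V x + K)%:E)%E ->
  forall (x0 : X), (forall w, Xi 0%N w = x0) ->
  forall n, (\int[Pr]_w (V (Xi n w))%:E <= (V x0 + K * n%:R)%:E)%E.
Proof.
move=> mV V0 K0 PV x0 X0; elim=> [|n ih].
  under eq_integral do rewrite X0.
  rewrite integral_cst//= [X in (_ * X)%E](probability_setT Pr).
  by rewrite mule1 mulr0 addr0.
have mVX m : measurable_fun setT (fun w => V (Xi m w)).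
  exact: measurableT_comp mV (measurable_funPT (Xi m)).
rewrite (@step_integral n (fun z => (V z.2)%:E)); last 2 first.
- by move=> z; rewrite lee_fin.
- by apply/measurable_EFinP; exact: measurableT_comp mV measurable_snd.
rewrite /=.
apply: (@le_trans _ _ (\int[Pr]_w ((V (Xi n w))%:E + K%:E))%E).
  apply: ge0_le_integral => //.
  - by move=> w _; apply: integral_ge0 => y _; rewrite lee_fin.
  - have mk : measurable_fun setT (fun x => \int[P x]_y (V y)%:E)%E.
      apply: measurable_fun_integral_kernel => //.
      - by move=> U mU; exact: measurable_kernel.
      - exact/measurable_EFinP.
    apply: (measurableT_comp mk).
    exact: measurable_fun_pair.
  - by apply: emeasurable_funD => //; exact/measurable_EFinP.
rewrite ge0_integralD//; last 2 first.
- by move=> w _; rewrite lee_fin.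
- exact/measurable_EFinP.
rewrite integral_cst//= [X in (_ + _ * X)%E](probability_setT Pr) mule1.
by rewrite -natr1 mulrDr mulr1 addrA EFinD leeD2r.
Qed.

Section stopped_comparison.
Variable f : X -> R.
Hypotheses (mf : measurable_fun setT f) (f01 : forall x, 0 <= f x <= 1).
Let F := propagate P f.

Let mF n : measurable_fun setT (F n).
Proof. exact: propagate_measurable. Qed.

Let F01 n z : 0 <= F n z <= 1.
Proof. exact: propagate01. Qed.

(* One step with the parameter [u.1.2], then [n] steps with the parameter [u.2]. *)
Let mixed n (u : (X * Y) * Y) := \int[P u.1]_y F n (y, u.2).

Let mixed_kernel := kernel_precomp P (@measurable_fst _ _ (X * Y)%type Y).

Let mixed_integrand n (z : ((X * Y) * Y) * X) := F n (z.2, z.1.2).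

Let mixed_integrand_measurable n : measurable_fun setT (mixed_integrand n).
Proof.
apply: measurableT_comp (mF n) _; apply: measurable_fun_pair => //.
exact: measurableT_comp measurable_snd measurable_fst.
Qed.

Let mixed_measurable n : measurable_fun setT (mixed n).
Proof.
by apply: (kernel_average_measurable mixed_kernel
  (mixed_integrand_measurable n)) => z; exact: F01.
Qed.

Let mixed01 n u : 0 <= mixed n u <= 1.
Proof.
by apply: (kernel_average01 mixed_kernel (mixed_integrand_measurable n)) => z;
  exact: F01.
Qed.

Let mixed_fin n u : (mixed n u)%:E = (\int[P u.1]_y (F n (y, u.2))%:E)%E.
Proof.
by apply: (kernel_average_fin mixed_kernel (mixed_integrand_measurable n)) => z;
  exact: F01.
Qed.

(** One step of the adaptive chain on an event [B] of its past; the frozen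
parameter [Gam i] belongs to the past as well. *)
Lemma stopped_step n i m (B : set (n.+1.-tuple (Y * X) * Y)) :
  measurable B -> (i <= n.+1)%N ->
  \int[Pr]_w (\1_B (past n w) * F m (Xi n.+1 w, Gam i w)) =
  \int[Pr]_w (\1_B (past n w) * mixed m ((Xi n w, Gam n.+1 w), Gam i w)).
Proof.
move=> mB ni; rewrite /Rintegral; congr fine.
pose h (z : (n.+1.-tuple (Y * X) * Y) * X) :=
  (\1_B z.1 * F m (z.2, past_param i z.1))%:E.
have h0 z : (0 <= h z)%E.
  by rewrite lee_fin mulr_ge0//; have /andP[] := F01 m (z.2, past_param i z.1).
have mh : measurable_fun setT h.
  apply/measurable_EFinP; apply: measurable_funM.
    exact: measurableT_comp (measurable_indic mB) measurable_fst.
  apply: measurableT_comp (mF m) _; apply: measurable_fun_pair => //.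
  exact: measurableT_comp (past_param_measurable i) measurable_fst.
transitivity (\int[Pr]_w h (past n w, Xi n.+1 w))%E.
  by apply: eq_integral => w _; rewrite /h /= past_paramE.
rewrite step_integral//; apply: eq_integral => w _; rewrite /h /= past_paramE//.
under eq_integral do rewrite EFinM.
rewrite ge0_integralZl_EFin//; first by rewrite EFinM mixed_fin.
- by move=> y _; rewrite lee_fin; have /andP[] := F01 m (y, Gam i w).
- apply/measurable_EFinP.
  exact: measurableT_comp (mF m) (measurable_pair2 (Gam i w)).
Qed.

Variables (s t : nat) (c : nat -> R).
Hypothesis c_ge0 : forall i, 0 <= c i.

(* The test made at step [s + i.+1]: for the function that remains to be averaged,
   moving with the current parameter [g'] exceeds moving with the frozen parameter
   [g] by at most [c i]. Its outcome depends only on the past of the step. *)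
Let close_at i (x : X) (g g' : Y) : bool :=
  mixed (t - i.+1) ((x, g'), g) <= F (t - i) (x, g) + c i.

Let good j : set Om := [set w | forall i, (i < j)%N ->
  close_at i (Xi (s + i)%N w) (Gam s w) (Gam (s + i).+1 w)].

Let past_good j : set ((s + j).+1.-tuple (Y * X) * Y) :=
  [set z | forall i, (i < j.+1)%N ->
    close_at i (past_state (s + i) z) (past_param s z) (past_param (s + i).+1 z)].

Let past_good_measurable (j : nat) : measurable (@past_good j).
Proof.
rewrite (_ : @past_good j = \bigcap_(i in [set i | (i < j.+1)%N])
  [set z | close_at i (past_state (s + i) z) (past_param s z)
                    (past_param (s + i).+1 z)])//.
apply: bigcap_measurable; first by exists 0%N.
move=> i _; rewrite -[X in measurable X]setTI.
apply: (@measurable_fun_ler _ _ _ setT) => //.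
  apply: measurableT_comp (mixed_measurable _) _.
  apply: measurable_fun_pair; last exact: past_param_measurable.
  apply: measurable_fun_pair; first exact: past_state_measurable.
  exact: past_param_measurable.
apply: measurable_funD => //; apply: measurableT_comp (mF _) _.
apply: measurable_fun_pair; first exact: past_state_measurable.
exact: past_param_measurable.
Qed.

Let goodS j : good j.+1 = past (s + j) @^-1` @past_good j.
Proof.
have pastE i w : (i < j.+1)%N ->
    close_at i (past_state (s + i) (past (s + j) w)) (past_param s (past (s + j) w))
      (past_param (s + i).+1 (past (s + j) w)) =
    close_at i (Xi (s + i)%N w) (Gam s w) (Gam (s + i).+1 w).
  move=> ij; have sij : (s + i <= s + j)%N by rewrite leq_add2l.
  by rewrite past_stateE// !past_paramE// leqW// leq_addr.
by apply/seteqP; split => w h i ij; have := h i ij; rewrite pastE.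
Qed.

Let good_measurable j : measurable (good j).
Proof.
case: j => [|j].
  by rewrite (_ : good 0 = setT)//; apply/seteqP; split => // w _ i.
rewrite goodS -[X in measurable X]setTI.
exact: (@past_measurable (s + j) measurableT _ (@past_good_measurable j)).
Qed.

(* The expectation of [f (Xi (s + t))] for the process that is adaptive up to time
   [s + j] and frozen afterwards, restricted to the paths that have passed all the
   tests so far. *)
Let value j := \int[Pr]_w (\1_(good j) w * F (t - j) (Xi (s + j)%N w, Gam s w)).

Let value_integrand01 j w :
  0 <= \1_(good j) w * F (t - j) (Xi (s + j)%N w, Gam s w) <= 1.
Proof.
have /andP[F0 F1] := F01 (t - j) (Xi (s + j)%N w, Gam s w).
rewrite mulr_ge0//= indicE; case: (_ \in _); first by rewrite mul1r.
by rewrite mul0r.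
Qed.

Let value_integrand_measurable j :
  measurable_fun setT (fun w => \1_(good j) w * F (t - j) (Xi (s + j)%N w, Gam s w)).
Proof.
apply: measurable_funM; first exact: measurable_indic.
by apply: measurableT_comp (mF _) _; exact: measurable_fun_pair.
Qed.

(* The test of step [s + j.+1] depends on the past of this step, so its indicator
   stays outside the conditional expectation, where it provides the bound [c j];
   dropping the paths that fail can only decrease the left-hand side. *)
Let valueS j : (j < t)%N -> value j.+1 <= value j + c j.
Proof.
move=> jt; rewrite /value addnS.
have -> : \int[Pr]_w (\1_(good j.+1) w * F (t - j.+1) (Xi (s + j).+1 w, Gam s w)) =
    \int[Pr]_w (\1_(@past_good j) (past (s + j) w) *
                F (t - j.+1) (Xi (s + j).+1 w, Gam s w)).
  by apply: eq_Rintegral => w _; rewrite goodS !indicE.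
rewrite stopped_step//; last by rewrite leqW// leq_addr.
have iv := bounded01_integrable Pr (@value_integrand_measurable j)
  (value_integrand01 j).
rewrite -[X in _ + X](probability_Rintegral_cst Pr).
rewrite -(RintegralD measurableT iv (probability_integrable_cst Pr (c j))).
have m01 w : 0 <= \1_(@past_good j) (past (s + j) w) *
    mixed (t - j.+1) (Xi (s + j)%N w, Gam (s + j).+1 w, Gam s w) <= 1.
  have /andP[F0 F1] :=
    mixed01 (t - j.+1) (Xi (s + j)%N w, Gam (s + j).+1 w, Gam s w).
  rewrite mulr_ge0//= indicE; case: (_ \in _); first by rewrite mul1r.
  by rewrite mul0r.
apply: le_Rintegral => //.
- apply: bounded01_integrable => //; apply: measurable_funM.
    exact: measurableT_comp (measurable_indic (@past_good_measurable j))
      (@past_measurable _).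
  apply: measurableT_comp (mixed_measurable _) _.
  by apply: measurable_fun_pair => //; apply: measurable_fun_pair.
- exact: (integrableD measurableT iv (probability_integrable_cst Pr (c j))).
move=> w _; rewrite [in leLHS]indicE.
rewrite -[_ \in @past_good j]/(w \in past (s + j) @^-1` @past_good j).
rewrite -goodS; case: (boolP (w \in good j.+1)) => [/set_mem wj|_].
  have wj' : good j w by move=> i ij; exact/wj/ltnW.
  rewrite indicE mem_set// !mul1r; exact: wj.
rewrite mul0r; apply: addr_ge0; last exact: c_ge0.
by have /andP[] := value_integrand01 j w.
Qed.

(** Replacing the adaptive steps by frozen ones, one at a time. The event [E]
lies in the event that all tests succeed, so the paths dropped at a failing test
have total mass at most [e]. *)
Lemma frozen_comparison (E : set Om) (e : R) :
  measurable E -> ((1 - e)%:E <= Pr E)%E ->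
  (forall w x i, E w -> (i < t)%N ->
    mixed (t - i.+1) ((x, Gam (s + i).+1 w), Gam s w) <=
      F (t - i) (x, Gam s w) + c i) ->
  \int[Pr]_w f (Xi (s + t)%N w) <=
    \int[Pr]_w F t (Xi s w, Gam s w) + \sum_(i < t) c i + e.
Proof.
move=> mE PE closeE.
have Egood : E `<=` good t by move=> w Ew i it; exact: closeE.
have value_le j : (j <= t)%N -> value j <= value 0 + \sum_(i < j) c i.
  elim: j => [|j ih] jt; first by rewrite big_ord0 addr0.
  rewrite big_ord_recr /= addrA; apply: le_trans (valueS jt) _.
  by rewrite lerD2r ih// ltnW.
have value0 : value 0 = \int[Pr]_w F t (Xi s w, Gam s w).
  by apply: eq_Rintegral => w _; rewrite addn0 subn0 indicE mem_set ?mul1r.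
have PrE : Pr (~` good t) = (1 - Pr (good t))%E by rewrite probability_setC.
have bad_le : fine (Pr (~` good t)) <= e.
  rewrite -lee_fin fineK ?fin_num_measure//; last exact: measurableC.
  rewrite PrE leeBlDr; last exact: fin_num_measure.
  have : (Pr E <= Pr (good t))%E by rewrite le_measure ?inE.
  move=> h; rewrite -leeBlDl// -EFinB.
  exact: le_trans PE h.
rewrite -value0; apply: (@le_trans _ _ (value t + e)); last first.
  by rewrite lerD2r value_le.
have iv := bounded01_integrable Pr (@value_integrand_measurable t)
  (value_integrand01 t).
have mb : measurable (~` good t) by exact: measurableC.
have ib : Pr.-integrable setT (EFin \o \1_(~` good t)).
  by apply: integrable_indic => //; rewrite (le_lt_trans (probability_le1 _ _))// ltry.
have badE : \int[Pr]_w \1_(~` good t) w = fine (Pr (~` good t)).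
  by rewrite /Rintegral integral_indic// setIT.
apply: (@le_trans _ _ (value t + \int[Pr]_w \1_(~` good t) w)); last first.
  by rewrite lerD2l badE.
rewrite /value -(RintegralD measurableT iv ib).
apply: le_Rintegral => //.
- by apply: bounded01_integrable => //; exact: measurableT_comp mf (measurable_funPT _).
- exact: (integrableD measurableT iv ib).
move=> w _; rewrite subnn /= !indicE in_setC.
case: (w \in good t); first by rewrite mul1r addr0.
by rewrite mul0r add0r; have /andP[] := f01 (Xi (s + t)%N w).
Qed.

End stopped_comparison.
End adapted_chain.

Section parameter_drift.
Context dX dY (X : measurableType dX) (Y : measurableType dY) (R : realType).
Variables (P : R.-pker (X * Y) ~> X).
Hypothesis mdiag : measurable [set z : X * X | z.1 <> z.2].

Lemma parameter_drift (g : nat -> Y) (x : X) (h : X -> R) (eta : R) s k :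
  measurable_fun setT h -> (forall x, 0 <= h x <= 1) ->
  (forall i, (s <= i)%N -> (tv (P (x, g i.+1)) (P (x, g i)) <= eta%:E)%E) ->
  \int[P (x, g (s + k)%N)]_y h y <= \int[P (x, g s)]_y h y + k%:R * eta.
Proof.
move=> mh h01 tvg; elim: k => [|k ih]; first by rewrite addn0 mul0r addr0.
have := tv_Rintegral_le mdiag (mu := kernel_law P (x, g (s + k).+1))
  (nu := kernel_law P (x, g (s + k)%N)) mh h01 (tvg _ (leq_addr _ _)).
rewrite addnS -natr1 mulrDl mul1r addrA => /le_trans; apply.
by rewrite lerD2r.
Qed.

End parameter_drift.

(** * The bound for the adaptive process *)

(** The infimum that defines the generalized inverse of [1 / G] is attained, as it
is taken over a nonempty set of natural numbers; rounding does not change it. *)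
Lemma recip_inv_ceil (R : realType) (G : nat -> R) (u : R) :
  (forall n, (0 < n)%N -> 0 < G n) -> G @ \oo --> (0 : R) -> 0 < u ->
  let n := `|Num.ceil (recip_inv G u)|%N in (0 < n)%N /\ G n <= u^-1.
Proof.
move=> G0 Glim u0.
have exS : exists n, (0 < n)%N && (u <= (G n)^-1).
  have u10 : 0 < u^-1 by rewrite invr_gt0.
  move/cvgrPdist_le : Glim => /(_ _ u10)[N _ hN].
  exists N.+1 => /=; have := hN N.+1 (leqnSn N) .
  rewrite sub0r normrN ger0_norm ?(ltW (G0 _ _))// => GN.
  by rewrite -(invrK u) lef_pV2 ?posrE ?G0.
have [m /andP[m0 um] mmin] := ex_minnP exS.
have infE : recip_inv G u = m%:R.
  apply/eqP; rewrite eq_le; apply/andP; split.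
    by apply: ge_inf; [exists 0 => _ [s _ <-]|exists m].
  apply: lb_le_inf; first by exists m%:R; exists m.
  by move=> _ [s [s0 us] <-]; rewrite ler_nat mmin// s0.
rewrite infE -[m%:R]/((m%:Z)%:~R) intrKceil /=; split => //.
by rewrite -(invrK (G m)) lef_pV2 ?posrE ?invr_gt0 ?G0.
Qed.

Lemma sum_succ_scaled (R : realType) (eta : R) t :
  \sum_(i < t) i.+1%:R * eta = t%:R * (t%:R + 1) / 2 * eta.
Proof.
elim: t => [|t ih]; first by rewrite big_ord0 !mul0r.
rewrite big_ord_recr ih /= -!natr1; by field.
Qed.

(** The whole error apart from the first term of the bound: [lag / t] and [q^-1]
come from the frozen chain, and [eps / (2 * t)] is the excess over [eps / 2] of
the accumulated changes of the kernels. Since [H] is finite, its inverse and hence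
[q] tend to infinity. *)
Lemma eventually_within_slack (R : realType) (phi : R -> R) (delta alpha lag eps : R) :
  (forall v : R, 0 <= v -> 0 <= phi v) -> concave_on `[0, +oo[ phi ->
  (forall u v : R, 0 <= u -> u < v -> phi u < phi v) ->
  0 < delta -> 0 < alpha < 1 -> 0 <= lag -> 0 < eps ->
  \forall t \near \oo,
    let Hinv := H1_inv delta phi in
    let q := - ln (Hinv t%:R) / ln (1 - alpha) + 1 in
    [/\ (0 < t)%N, 1 <= q & lag / t%:R + eps / (2 * t%:R) + q^-1 <= eps / 2].
Proof.
move=> phi_ge0 phi_concave phi_incr delta_gt0 /andP[alpha0 alpha1] lag0 eps0.
pose a := - ln (1 - alpha).
have a0 : 0 < a by rewrite oppr_gt0 ln_lt0// subr_gt0 alpha1/= ltrBlDr ltrDl.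
pose b := expR (4 / eps * a).
have b1 : 1 <= b by rewrite -expR0 ler_expR mulr_ge0 ?divr_ge0 ?ltW.
near=> t; rewrite /=; set Hinv := H1_inv delta phi; set q := - ln _ / _ + 1.
have t0 : 0 < t%:R :> R.
  by rewrite (lt_le_trans ltr01)//; near: t; exact: nbhs_infty_ger.
have tH : H1 delta phi b < t%:R.
  by near: t; exact: nbhs_infty_gtr.
have tlag : (4 * lag + 2 * eps) / eps <= t%:R by near: t; exact: nbhs_infty_ger.
have bH := H1_inv_gt phi_ge0 phi_concave phi_incr delta_gt0 b1 tH.
have qE : q = ln (Hinv t%:R) / a + 1 by rewrite /q /a invrN mulrN mulNr.
have q4 : 4 / eps + 1 <= q.
  rewrite qE lerD2r ler_pdivlMr// -[leLHS]expRK ler_ln ?posrE ?expR_gt0//.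
    exact: ltW.
  exact: lt_trans (expR_gt0 _) bH.
have e4 : 0 < 4 / eps by rewrite divr_gt0.
have q1 : 1 <= q by lra.
split => //; first by rewrite -(ltr_nat R).
have h1 : lag / t%:R + eps / (2 * t%:R) <= eps / 4.
  rewrite (_ : _ + _ = (lag + eps / 2) / t%:R); last by field; rewrite gt_eqF.
  rewrite ler_pdivrMr//; move: tlag; rewrite ler_pdivrMr//; lra.
have h2 : q^-1 <= eps / 4.
  rewrite -[leRHS]invrK lef_pV2 ?posrE ?invr_gt0 ?divr_gt0//; last lra.
  by rewrite invf_div; lra.
lra.
Unshelve. all: by end_near.
Qed.

Theorem theorem10 (R : realType) (X Y : ptopologicalType)
  (polishX : polish R X)
  (pi : probability (borel X) R)
  (P : R.-pker (borel X * borel Y) ~> borel X)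
  (Q : forall t : nat, R.-pker (t.-tuple (borel Y * borel X)) ~> borel Y)
  (gam0 : Y) (x0 : X)
  (d : measure_display) (Om : measurableType d) (Pr : probability Om R)
  (Gam : nat -> {mfun Om >-> borel Y}) (Xi : nat -> {mfun Om >-> borel X})
  (proc : adaptive_process P Q gam0 x0 Pr Gam Xi)
  (* 1. invariance *)
  (invariant : forall (g : Y) (A : set (borel X)), measurable A ->
    (\int[pi]_x P (x, g) A)%E = pi A)
  (* 2. simultaneous subgeometric drift *)
  (V : borel X -> R) (phi : R -> R) (K : R)
  (V_meas : measurable_fun setT V)
  (V_ge1 : forall x, 1 <= V x)
  (V_int : (\int[pi]_x (V x)%:E < +oo)%E)
  (phi_ge0 : forall v, 0 <= v -> 0 <= phi v)
  (phi_concave : concave_on `[0, +oo[ phi)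
  (phi_incr : forall u v, 0 <= u -> u < v -> phi u < phi v)
  (phi_infty : phi v @[v --> +oo] --> +oo)
  (phi_sublinear : phi v / v @[v --> +oo] --> (0 : R))
  (K_ge0 : 0 <= K)
  (drift : forall (x : X) (g : Y),
    (\int[P (x, g)]_y (V y)%:E - (V x)%:E <= (- phi (V x) + K)%:E)%E)
  (* 3. simultaneous local contraction *)
  (delta alpha : R)
  (delta01 : 0 < delta < 1)
  (alpha01 : 0 < alpha < 1)
  (contraction : forall (x y : X) (g : Y),
    V x + V y <= phi_inv phi (2 * K / (1 - delta)) ->
    (tv (P (x, g)) (P (y, g)) <= (1 - alpha)%:E)%E)
  (* 4. quantitative diminishing adaptation *)
  (G : nat -> R) (s : R -> nat)
  (G_gt0 : forall n, (0 < n)%N -> 0 < G n)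
  (G_decr : forall m n, (0 < m)%N -> (m < n)%N -> G n < G m)
  (G_lim : G @ \oo --> (0 : R))
  (diminishing : forall eps : R, 0 < eps < 1 ->
    let E := [set w : Om | forall (x : X) (t : nat),
      (0 < t)%N -> (s eps <= t)%N ->
      (tv (P (x, Gam t.+1 w)) (P (x, Gam t w)) <= (G t)%:E)%E] in
    measurable E /\ ((1 - eps)%:E <= Pr E)%E) :
  forall eps : R, 0 < eps < 1 ->
    \forall t \near \oo,
      let T := (s eps + `|Num.ceil (recip_inv G (t%:R ^+ 2 / eps))|)%N in
      let Rad := phi_inv phi (2 * K / (1 - delta)) in
      let r := rate delta phi in
      let Hinv := H1_inv delta phi in
      let C := r 1 / r 0 * (Rad + 2 * K * r 1 / r 0) in
      (tv (distribution Pr (Xi (T + t)%N)) pi <=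
        ((2 + r 1 / r 0 * (V x0 + \int[pi]_x V x + K * T%:R) + C)
           / Hinv (t%:R / (- ln (Hinv t%:R) / ln (1 - alpha) + 1))
         + 2 * eps)%:E)%E.
Proof.
move=> eps /andP[eps0 eps1].
have mdiag := polish_diagonal_measurable polishX.
have delta0 : 0 < delta by case/andP: delta01.
have alpha0 : 0 < alpha by case/andP: alpha01.
pose lag := coupling_lag phi K delta alpha.
have lag0 : 0 <= lag by exact: coupling_lag_ge0.
have V0 x : 0 <= V x by exact: le_trans (V_ge1 x).
have piV : pi.-integrable setT (EFin \o V) by exact: nonneg_integrable.
have step := step_state proc.
near=> t.
have [t0 q1 slack] : [/\ (0 < t)%N,
    1 <= - ln (H1_inv delta phi t%:R) / ln (1 - alpha) + 1 &
    lag / t%:R + eps / (2 * t%:R) +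
      (- ln (H1_inv delta phi t%:R) / ln (1 - alpha) + 1)^-1 <= eps / 2].
  near: t; exact: eventually_within_slack.
set q := - ln _ / _ + 1 in q1 slack *.
set n := `|Num.ceil _|%N; set T := (s eps + n)%N.
set Rad := phi_inv phi _; set r := rate delta phi.
set C := r 1 / r 0 * (Rad + _).
set Hinv := H1_inv delta phi in q q1 slack *.
have t0R : 0 < t%:R :> R by rewrite ltr0n.
have q0 : 0 < q by exact: lt_le_trans q1.
have tq0 : 0 <= t%:R / q by rewrite divr_ge0 ?ltW.
pose M := Hinv (t%:R / q).
have M1 : 1 <= M by exact: H1_inv_ge1.
have HM : H1 delta phi M = t%:R / q by exact: H1_invK.
rewrite -/M.
have [n0 Gn0] := recip_inv_ceil G_gt0 G_lim (u := t%:R ^+ 2 / eps)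
  (divr_gt0 (exprn_gt0 2 t0R) eps0).
rewrite -/n in n0 Gn0.
rewrite invf_div in Gn0.
(* A bound for every change of the kernels after time [T]. *)
pose eta := eps / t%:R ^+ 2.
have GT i : (T <= i)%N -> G i <= eta.
  move=> Ti; apply: le_trans Gn0.
  have : (n <= i)%N by rewrite (leq_trans _ Ti)// leq_addl.
  by rewrite leq_eqVlt => /predU1P[->//|ni]; exact/ltW/G_decr.
pose VT := \int[Pr]_w V (Xi T w).
have mVX : measurable_fun setT (fun w => V (Xi T w)).
  exact: measurableT_comp V_meas (measurable_funPT (Xi T)).
have meanV : (\int[Pr]_w (V (Xi T w))%:E <= (V x0 + K * T%:R)%:E)%E.
  apply: (mean_drift step) => // [x g|w]; last exact: init_state proc w.
  apply: le_trans (@drift_integral_le _ _ (borel X) (borel Y) R P V phi K drift x g) _.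
  by rewrite lee_fin lerD2r gerDl oppr_le0 phi_ge0.
have VT_int : Pr.-integrable setT (EFin \o (fun w => V (Xi T w))).
  by apply: nonneg_integrable => //; exact: le_lt_trans meanV (ltry _).
have VT_le : VT <= V x0 + K * T%:R.
  by rewrite -lee_fin /VT /Rintegral fineK//; exact: integrable_fin_num VT_int.
apply: (tv_le mdiag (mu := distribution Pr (Xi (T + t)%N))) => A mA.
pose f : borel X -> R := \1_A.
have mf : measurable_fun setT f by exact: measurable_indic.
have f01 x : 0 <= f x <= 1 by rewrite /f indicE; case: (_ \in _); rewrite ?lexx ?ler01.
have [mE PE] := diminishing _ (introT andP (conj eps0 eps1)).
pose piVm := \int[pi]_x V x.
have cmp : \int[Pr]_w f (Xi (T + t)%N w) <=
    \int[Pr]_w propagate P f t (Xi T w, Gam T w) +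
    \sum_(i < t) i.+1%:R * eta + eps.
  apply: (frozen_comparison step mf f01 (c := fun i => i.+1%:R * eta) _ mE PE).
    by move=> i; rewrite mulr_ge0 ?divr_ge0 ?exprn_ge0 ?ltW.
  move=> w x i Ew it; rewrite -(subnSK it) propagateS -addnS.
  apply: (parameter_drift mdiag (g := fun k => Gam k w)).
  - exact: measurableT_comp (propagate_measurable P mf f01 _) (measurable_pair2 _).
  - by move=> y; exact: propagate01.
  - move=> k Tk; apply: le_trans (Ew x k _ _) _.
    + by rewrite (leq_trans _ Tk)// (leq_trans n0)// leq_addl.
    + by rewrite (leq_trans _ Tk)// leq_addr.
    + by rewrite lee_fin GT.
pose a := \int[pi]_x f x + (lag + t%:R / q) / t%:R + piVm / M.
have frozen w : propagate P f t (Xi T w, Gam T w) <= a + M^-1 * V (Xi T w).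
  rewrite /a -HM.
  have := @frozen_convergence _ _ (borel X) (borel Y) R P mdiag V phi K delta alpha
    V_meas V_ge1 phi_ge0 phi_concave phi_incr phi_infty K_ge0 delta01 alpha01
    drift contraction f mf f01 pi t M (Xi T w) (Gam T w) t0 M1 piV (invariant _).
  by rewrite -/lag -/piVm (mulrDl (V _)); lra.
have cst_int := probability_integrable_cst Pr a.
have MV_int : Pr.-integrable setT (EFin \o (fun w => M^-1 * V (Xi T w))).
  exact: (integrableZl measurableT M^-1 VT_int).
have mean_frozen : \int[Pr]_w propagate P f t (Xi T w, Gam T w) <= a + M^-1 * VT.
  have -> : a + M^-1 * VT = \int[Pr]_w (a + M^-1 * V (Xi T w)).
    rewrite (RintegralD measurableT cst_int MV_int).
    rewrite (RintegralZl M^-1 measurableT VT_int).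
    by congr (_ + _); rewrite [RHS]probability_Rintegral_cst.
  apply: le_Rintegral => //.
  - apply: bounded01_integrable; last by move=> w; exact: propagate01.
    apply: measurableT_comp (propagate_measurable P mf f01 t) _.
    exact: measurable_fun_pair.
  - exact: (integrableD measurableT cst_int MV_int).
have fE (k : probability (borel X) R) : (\int[k]_x f x)%:E = k A.
  rewrite /Rintegral integral_indic// setIT fineK//.
  by rewrite fin_num_measure.
have lawE : (\int[Pr]_w f (Xi (T + t)%N w))%:E = distribution Pr (Xi (T + t)%N) A.
  rewrite -fE; congr EFin; rewrite /Rintegral; congr fine.
  rewrite (ge0_integral_distribution (Xi (T + t)%N))//.
    exact/measurable_EFinP.
  by move=> y; rewrite lee_fin; have /andP[] := f01 y.
rewrite -[leLHS]lawE -[X in (_ <= X + _)%E](fE pi) -EFinD lee_fin.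
apply: (le_trans cmp).
have M0 : 0 < M by exact: lt_le_trans M1.
(* The remaining terms of the numerator are nonnegative and [r 1 / r 0] is at
   least 1. *)
have num_le : VT + piVm <= 2 + r 1 / r 0 * (V x0 + piVm + K * T%:R) + C.
  have ratio1 : 1 <= r 1 / r 0 by exact: rate_ratio_ge1.
  have r0_ge0 u : 0 <= u -> 0 <= r u.
    move=> u0; rewrite mulr_ge0 ?(ltW delta0)// phi_ge0// (le_trans ler01)//.
    exact: H1_inv_ge1.
  have C0 : 0 <= C.
    rewrite mulr_ge0 ?(le_trans ler01 ratio1)// addr_ge0//.
      rewrite /Rad /phi_inv; set L := (X in inf X).
      have [->|/set0P L0] := eqVneq L set0; first by rewrite inf0.
      by apply: lb_le_inf => // v [].
    by rewrite divr_ge0 ?r0_ge0// mulr_ge0 ?r0_ge0// mulr_ge0.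
  have piV0 : 0 <= piVm by apply: Rintegral_ge0 => x _.
  have S0 : 0 <= V x0 + piVm + K * T%:R by rewrite !addr_ge0// mulr_ge0.
  have : V x0 + piVm + K * T%:R <= r 1 / r 0 * (V x0 + piVm + K * T%:R).
    by rewrite ler_peMl.
  lra.
have num_leM : (VT + piVm) / M <=
    (2 + r 1 / r 0 * (V x0 + piVm + K * T%:R) + C) / M.
  by rewrite ler_pM2r ?invr_gt0.
have sumE : \sum_(i < t) i.+1%:R * eta = eps / 2 + eps / (2 * t%:R).
  rewrite sum_succ_scaled /eta; field; exact: lt0r_neq0.
have aE : a + M^-1 * VT = \int[pi]_x f x + lag / t%:R + q^-1 + (VT + piVm) / M.
  rewrite /a; field; rewrite !lt0r_neq0//.
rewrite sumE -/piVm; move: mean_frozen num_leM slack; rewrite aE.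
move: (_ / M) ((VT + _) / M) (lag / _) (eps / (2 * _)) q^-1 => *.
lra.
Unshelve. all: by end_near.
Qed.
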